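(* For $n\ge 2$ let $$s_n(z):=\frac{1}{n-1}\,\frac{\widetilde{\Xi}_n'(z)}{\widetilde{\Xi}_n(z)},\qquad z\in\mathbb{C}\setminus[0,1].$$ Fix an analytic branch of $\sqrt{z}$ on $\mathbb{C}\setminus[0,1]$ and set $$u(z):=\frac{\sqrt{z}-1}{\sqrt{z}+1}.$$ Then $|u(z)|<1$ for $z\in\mathbb{C}\setminus[0,1]$, and for every such $z$ we have $s_n(z)\to s(z)$ as $n\to\infty$, locally uniformly, where $$s(z)=\frac{1}{\sqrt{z}\,\bigl(1+\sqrt{z}\bigr)}+\frac{1}{\sqrt{z}\,\bigl(1-\sqrt{z}\bigr)}\left(u(z)+\frac{1-u(z)}{\log u(z)}\right).$$
   Context: $B_m$ denotes the Eulerian polynomial of type $B$ of degree $m$; it satisfies $\sum_{k\ge 0}(2k+1)^m x^k = B_m(x)/(1-x)^{m+1}$ for $|x|<1$. For $n\ge 1$, $$\Xi_n(x)=\frac{(-1)^{n+1}}{2^{4n-1}(2n-1)!}\,\frac{(1+x)^{2n-1}}{x}\,B_{2n-1}\!\left(-\frac{1-x}{1+x}\right),$$ and for $n\ge 2$, $\widetilde{\Xi}_n(x):=\Xi_n(\sqrt{x})$, which is a real polynomial of degree $n-1$. Its zeros in $(0,1)$ are written $0<x_{n,1}\le\cdots\le x_{n,n-1}<1$, and $s_n$ is the Stieltjes transform $\int_{\mathbb{R}}\frac{1}{z-x}\,\mu_n(dx)$ of the empirical zero measure $\mu_n=\frac{1}{n-1}\sum_{k=1}^{n-1}\delta_{x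_{n,k}}$.
   Formalization: No analytic branch of √z exists on C∖[0,1], and |u|=1 on (−∞,0). The branch is taken analytic off (−∞,1] with either root on (−∞,0); |u|<1 is claimed only on C∖(−∞,1], for the branch positive on (1,∞). Convergence is claimed on all of C∖[0,1]. *)

(* Defs.v *)
From HB Require Import structures.
From mathcomp Require Import all_boot all_order all_algebra.
From mathcomp Require Import all_classical all_reals all_analysis.
From mathcomp Require Import complex.
From mathcomp Require Import ring lra.

Set Implicit Arguments.
Unset Strict Implicit.
Unset Printing Implicit Defensive.
Import Order.TTheory GRing.Theory Num.Theory numFieldNormedType.Exports.

Local Open Scope classical_set_scope.
Local Open Scope ring_scope.
Local Open Scope complex_scope.

(* The regular module [R[i]^o] is where the library puts the topology of R[i]. *)
Notation Cplx R := (R[i]^o).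

(* The type B Eulerian polynomial of degree m. Its coefficients are those of
   (1 - x)^(m+1) * \sum_(k >= 0) (2k+1)^m x^k, which vanish beyond degree m;
   [eulerianB_gf] below is the resulting generating function identity. *)
Definition eulerianB (K : nzRingType) (m : nat) : {poly K} :=
  \poly_(k < m.+1)
    \sum_(i < k.+1) (-1) ^+ (k - i) *+ 'C(m.+1, k - i) * (2 * i + 1)%:R ^+ m.

Section EulerianB.
Variable R : realType.
Local Notation C := (Cplx R).

Let bdiff (a : nat -> C) (k : nat) : C :=
  a k - (if k is k'.+1 then a k' else 0).

Let bdiff_iter (a : nat -> C) j k :
  iter j bdiff a k = \sum_(i < k.+1) (-1) ^+ (k - i) *+ 'C(j, k - i) * a i.
Proof.
elim: j k => [|j IH] k.
  rewrite big_ord_recr /= subnn bin0 expr0 mul1r big1 ?add0r// => i _.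
  have : (0 < k - i)%N by rewrite subn_gt0.
  by case: (k - i)%N => // p _; rewrite bin0n mulr0n mul0r.
rewrite iterS /bdiff; case: k => [|k].
  by rewrite IH !big_ord_recr !big_ord0 /= !subnn !bin0 subr0.
rewrite !IH big_ord_recr [RHS]big_ord_recr /= !subnn !bin0 addrAC -sumrB.
congr (_ + _); apply: eq_bigr => i _.
rewrite subSn ?leq_ord// binS exprS mulrnDr.
by rewrite mulN1r mulrDl -mulNr -mulNrn addrC.
Qed.

Let bdiff_poly (a : nat -> C) (s d : nat) (p : {poly C}) :
  (size p <= d)%N -> (forall k, (s <= k)%N -> a k = p.[k%:R]) ->
  exists2 q : {poly C}, (size q <= d.-1)%N &
    forall k, (s.+1 <= k)%N -> bdiff a k = q.[k%:R].
Proof.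
move=> pd ap; exists (p - (p \Po ('X - 1%:P))); last first.
  case=> // k; rewrite ltnS => sk; rewrite /bdiff !ap ?leqW//.
  by rewrite hornerD hornerN horner_comp !hornerE -natr1 addrK.
have sX : size ('X - 1%:P : {poly C}) = 2%N by rewrite size_XsubC.
have sz : size (p \Po ('X - 1%:P)) = size p by rewrite size_comp_poly2.
have lc : lead_coef (p \Po ('X - 1%:P)) = lead_coef p.
  by rewrite lead_coef_comp ?sX// lead_coefXsubC expr1n mulr1.
apply: leq_trans (_ : (size p).-1 <= _)%N; last by rewrite -!subn1 leq_sub2r.
apply/leq_sizeP => j; rewrite leq_eqVlt coefB => /orP[/eqP<-|pj].
  by rewrite -/(lead_coef p) -lc lead_coefE sz subrr.
have {}pj : (size p <= j)%N by apply: leq_trans pj; exact: leqSpred.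
by rewrite !nth_default ?sz// subrr.
Qed.

Let bdiff_vanish (m k : nat) : (m < k)%N ->
  iter m.+1 bdiff (fun k => (2 * k + 1)%:R ^+ m) k = 0.
Proof.
move=> mk.
have H j : (j <= m.+1)%N -> exists2 q : {poly C}, (size q <= m.+1 - j)%N &
    forall k, (j <= k)%N ->
    iter j bdiff (fun k => (2 * k + 1)%:R ^+ m) k = q.[k%:R].
  elim: j => [_|j IH jm].
    exists ((2%:R *: 'X + 1) ^+ m).
      rewrite subn0; apply: leq_trans (size_poly_exp_leq _ _) _.
      rewrite ltnS -[leqRHS]mul1n leq_mul2r; apply/orP; right.
      have : (size (2%:R *: 'X + 1 : {poly C})%R <= 2)%N.
        rewrite (leq_trans (size_polyD _ _))// geq_max size_poly1 andbT.
        by rewrite (leq_trans (size_scale_leq _ _))// size_polyX.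
      by case: (size _).
    by move=> i _ /=; rewrite !hornerE natrD natrM.
  have [q qs qE] := IH (ltnW jm).
  have [r rs rE] := bdiff_poly qs qE.
  by exists r; rewrite ?subnS.
have [q] := H m.+1 (leqnn _).
rewrite subnn leqn0 size_poly_eq0 => /eqP-> ->//.
by rewrite horner0.
Qed.

Let bdiff_cvg0 (a : nat -> C) (x : C) :
  a k * x ^+ k @[k --> \oo] --> (0 : C) ->
  bdiff a k * x ^+ k @[k --> \oo] --> (0 : C).
Proof.
move=> ax; rewrite -(cvg_shiftS (fun k => bdiff a k * x ^+ k)) /=.
have -> : (fun k => bdiff a k.+1 * x ^+ k.+1) =
    (fun k => a k.+1 * x ^+ k.+1 - x * (a k * x ^+ k)).
  by apply/funext => k; rewrite /bdiff exprS; ring.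
have ax1 : a k.+1 * x ^+ k.+1 @[k --> \oo] --> (0 : C).
  by rewrite (cvg_shiftS (fun k => a k * x ^+ k)).
have := cvgB ax1 (cvgMl_tmp (a := x) ax).
by rewrite mulr0 subr0; exact.
Qed.

Let bdiff_series (a : nat -> C) (x S : C) : 1 - x != 0 ->
  a k * x ^+ k @[k --> \oo] --> (0 : C) ->
  [series bdiff a k * x ^+ k]_k @ \oo --> S ->
  [series a k * x ^+ k]_k @ \oo --> (S / (1 - x) : C).
Proof.
move=> x1 ax bS.
pose e N := if N is N'.+1 then x * (a N' * x ^+ N') else 0.
have -> : [series a k * x ^+ k]_k =
   (fun N => ([series bdiff a k * x ^+ k]_k N - e N) / (1 - x)).
  apply/funext => N; apply: (canRL (mulfK x1)).
  elim: N => [|N IH]; first by rewrite /series /= !big_geq//= mul0r subr0.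
  move: IH; rewrite /series /= !big_nat_recr//= => IH.
  rewrite mulrDl IH /bdiff /e; case: N {IH} => [|N].
    by rewrite !big_geq// expr0; ring.
  by rewrite exprS; ring.
apply: cvgMr_tmp.
have e0 : e N @[N --> \oo] --> (0 : C).
  have := cvgMl_tmp (a := x) ax; rewrite mulr0 => xa.
  rewrite -(cvg_shiftS e).
  rewrite /e /=. 
  exact: xa.
have := cvgB bS e0; rewrite subr0 => bSe.
exact: bSe.
Qed.

Let pow_bound (m : nat) (q : R) : 0 <= q -> q < 1 ->
  exists M : R, forall k, (2 * k + 1)%:R ^+ m * q ^+ k <= M.
Proof.
elim: m q => [|m IH] q q0 q1.
  exists 1 => k; rewrite expr0 mul1r; exact: exprn_ile1 (ltW q1).
pose r := Num.sqrt q.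
have rr : q = r ^+ 2 by rewrite sqr_sqrtr.
have r0 : 0 <= r by exact: sqrtr_ge0.
have r1 : r < 1 by rewrite -(@ltr_pXn2r _ 2)// -?rr ?expr1n// nnegrE.
have [M HM] := IH r r0 r1.
have M0 : 0 <= M by apply: le_trans (HM 0%N); rewrite !expr1n mul1r expr0.
have lin k : (2 * k + 1)%:R * r ^+ k <= 1 + 2 / (1 - r).
  have d0 : 0 < 1 - r by rewrite subr_gt0.
  have : k%:R * (1 - r) * r ^+ k <= 1.
    elim: k => [|k IHk]; first by rewrite !mul0r.
    have rk1 : r ^+ k <= 1 by exact: exprn_ile1 (ltW r1).
    have rk0 : 0 <= r ^+ k by exact: exprn_ge0.
    have h1 : (k%:R * (1 - r) * r ^+ k) * r <= 1 * r by exact: ler_wpM2r.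
    have h2 : (1 - r) * (r * r ^+ k) <= (1 - r) * 1.
      by apply: ler_wpM2l; [exact: ltW|exact: mulr_ile1 (ltW r1) _].
    rewrite exprS -natr1.
    have -> : (k%:R + 1) * (1 - r) * (r * r ^+ k) =
      k%:R * (1 - r) * r ^+ k * r + (1 - r) * (r * r ^+ k) by ring.
    by lra.
  rewrite -mulrA mulrCA -ler_pdivlMl// mulr1 => kr.
  have rk1 : r ^+ k <= 1 by exact: exprn_ile1 (ltW r1).
  by rewrite natrD natrM mulrDl mul1r; lra.
exists (M * (1 + 2 / (1 - r))) => k.
have -> : (2 * k + 1)%:R ^+ m.+1 * q ^+ k =
    ((2 * k + 1)%:R ^+ m * r ^+ k) * ((2 * k + 1)%:R * r ^+ k).
  by rewrite rr exprSr -exprM mulnC exprM expr2; ring.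
by apply: ler_pM; rewrite ?mulr_ge0 ?exprn_ge0 ?ler0n.
Qed.

Let pow_cvg0 (m : nat) (x : C) : `|x| < 1 ->
  (2 * k + 1)%:R ^+ m * x ^+ k @[k --> \oo] --> (0 : C).
Proof.
move=> x1.
have [q0 q1] : 0 <= Normc.normc x /\ Normc.normc x < 1.
  split; last by rewrite -ltcR.
  by rewrite -lecR; exact: normr_ge0 (x : R[i]).
pose r := Num.sqrt (Normc.normc x).
have rr : Normc.normc x = r ^+ 2 by rewrite sqr_sqrtr.
have r0 : 0 <= r by exact: sqrtr_ge0.
have r1 : r < 1 by rewrite -(@ltr_pXn2r _ 2)// -?rr ?expr1n// nnegrE.
have [M HM] := pow_bound m r0 r1.
have M0 : 0 <= M by apply: le_trans (HM 0%N); rewrite !expr1n mul1r expr0.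
have cv : M * r ^+ k @[k --> \oo] --> (0 : R).
  by apply: cvg_geometric; rewrite ger0_norm.
apply/cvgr0Pnorm_lt => -[e e'] /[dup] /gtr0_real/complex_realP[{}e ->].
rewrite ltcR => e0.
have /cvgr0Pnorm_lt/(_ e e0) := cv.
apply: filterS => k.
have -> : `|(2 * k + 1)%:R ^+ m * x ^+ k| =
    ((2 * k + 1)%:R ^+ m * Normc.normc x ^+ k)%:C.
  rewrite normrM !normrX normr_nat.
  by rewrite rmorphM !rmorphXn rmorph_nat.
rewrite ltcR; apply: le_lt_trans.
rewrite ger0_norm ?mulr_ge0 ?exprn_ge0// rr exprAC expr2 mulrA.
by apply: ler_wpM2r; [exact: exprn_ge0|exact: HM].
Qed.

Lemma eulerianB_gf (m : nat) (x : C) : `|x| < 1 ->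
  [series (2 * k + 1)%:R ^+ m * x ^+ k]_k @ \oo -->
    ((eulerianB C m).[x] / (1 - x) ^+ m.+1 : C).
Proof.
move=> x1; pose a k : C := (2 * k + 1)%:R ^+ m.
have x1' : 1 - x != 0.
  by apply: contraTneq x1 => /subr0_eq <-; rewrite normr1 ltxx.
have a0 j : iter j bdiff a k * x ^+ k @[k --> \oo] --> (0 : C).
  by elim: j => [|j IH] /=; [exact: pow_cvg0|exact: bdiff_cvg0].
have H j : (j <= m.+1)%N ->
    [series iter (m.+1 - j) bdiff a k * x ^+ k]_k @ \oo -->
    ((eulerianB C m).[x] / (1 - x) ^+ j : C).
  elim: j => [_|j IH jm].
    rewrite subn0 expr0 divr1; apply: (@cvg_near_cst _ _ _ _ _).
    exists m.+1 => // N /= mN.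
    rewrite /series /= (big_cat_nat _ (n := m.+1))//= [X in _ + X]big_nat_cond.
    rewrite [X in _ + X]big1 ?addr0.
      rewrite horner_poly big_mkord; apply: eq_bigr => i _.
      by rewrite -iterS bdiff_iter.
    by move=> i /andP[/andP[mi _] _]; rewrite -iterS bdiff_vanish// mul0r.
  have := IH (ltnW jm); rewrite (_ : m.+1 - j = (m.+1 - j.+1).+1)%N; last first.
    by rewrite subnSK.
  move=> /(bdiff_series x1' (a0 _)).
  by rewrite -mulrA -invfM -exprSr.
by have := H m.+1 (leqnn _); rewrite subnn.
Qed.

End EulerianB.

Section Definitions.
Variable R : realType.
Local Notation C := (Cplx R).

Definition Xi (n : nat) (x : C) : C :=
  (-1) ^+ n.+1 / (2%:R ^+ (4 * n - 1) * ((2 * n - 1)`!)%:R)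
  * ((1 + x) ^+ (2 * n - 1) / x)
  * (eulerianB C (2 * n - 1)).[- ((1 - x) / (1 + x))].

(* [Xi n] is even for n >= 1, so the choice of the square root is immaterial;
   with [sqrtc], whose real part is nonnegative, the denominators x and 1 + x
   of [Xi] vanish at no square root except that of 0. *)
Definition XiTilde (n : nat) (z : C) : C := Xi n (sqrtc z).

Definition sn (n : nat) (z : C) : C :=
  1 / (n%:R - 1) * ((XiTilde n)^`()%classic z / XiTilde n z).

(* Principal argument, in ]-pi, pi], and principal logarithm. *)
Definition Carg (z : C) : R :=
  let t := acos (complex.Re z / Normc.normc z) in if 0 <= complex.Im z then t else - t.

Definition Clog (z : C) : C := ln (Normc.normc z) +i* Carg z.

Definition segment01 : set C := [set x%:C | x in `[0, 1]].

(* The real half-line ]-oo, 1]: the segment [0, 1] and the cut ]-oo, 0]. *)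
Definition halfline1 : set C := [set x%:C | x in `]-oo, 1]].

(* A branch of the square root for the cut ]-oo, 0]. There is no analytic, or
   even continuous, one on the whole of C \ [0, 1], since a loop around [0, 1]
   winds once around 0; on ]-oo, 0[ the value is either of the square roots. *)
Definition sqrt_branch (rt : C -> C) : Prop :=
  (forall z : C, ~ segment01 z -> rt z ^+ 2 = z) /\
  (forall z : C, ~ halfline1 z -> derivable rt z 1).

Definition ufun (rt : C -> C) (z : C) : C := (rt z - 1) / (rt z + 1).

Definition slim (rt : C -> C) (z : C) : C :=
  1 / (rt z * (1 + rt z))
  + 1 / (rt z * (1 - rt z))
    * (ufun rt z + (1 - ufun rt z) / Clog (ufun rt z)).

End Definitions.

(* Main.v *)
Require Import Defs.
From HB Require Import structures.
From mathcomp Require Import all_boot all_order all_algebra.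
From mathcomp Require Import all_classical all_reals all_analysis.
From mathcomp Require Import complex.
From mathcomp Require Import ring lra zify.
Set Implicit Arguments.
Unset Strict Implicit.
Unset Printing Implicit Defensive.
Import Order.TTheory GRing.Theory Num.Theory numFieldNormedType.Exports.
Local Open Scope classical_set_scope.
Local Open Scope ring_scope.
Local Open Scope complex_scope.

(** Write m = 2n - 1, let w be a square root of z, u = (w - 1) / (w + 1), and
    choose t with u = exp(-2t), that is t = - (Log u) / 2.  The substitution
    u = exp(-2t), which is w = coth t, turns the polynomial of the statement
    into an elementary factor times

      F_m(t) = (2k+1)^m exp(-(2k+1)t) summed over k
             = (-d/dt)^m (1 / (2 sinh t)),

    a rational function [oddgf] of exp(-t) that makes sense on both sides of
    the unit circle.  It is meromorphic with poles at the multiples of i pi,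
    and t = 0 is strictly the closest one as soon as |Im t| < pi/2, which is
    exactly the condition that u is not a negative real; u is 0 or a negative
    real only if z is in [0, 1].  Hence F_m(t) ~ (m!/2) t^(-m-1) as m grows.  As
    F_(m+1) = - F_m', the logarithmic derivative in z involves the ratio
    F_(m+1)(t) / F_m(t) ~ (m+1) / t and no estimate on derivatives is needed;
    the limit is 1 / (w (z - 1) t) ([snE], [sn_uniform]).  This expression and
    the closed form of the statement agree for both choices of the square
    root, because Log (1/u) = - Log u off the negative axis ([slimE]).

    The asymptotics ([oddexp_asymp]) are obtained without contour integrals
    or partial fraction series, by a variant of Herglotz's trick.  Averaging
    over the cube roots of unity gives

      3^(m+1) F_m(t) = F_m(t/3) - F_m((t + i pi)/3) - F_m((t - i pi)/3)

    ([oddgf_triple], [oddexp_triple]), and the three points on the right stay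
    in the strip |Im| <= pi/2.  The principal pole t^(-m-1) satisfies the same
    equation up to the two neighbouring poles, so the remainder of
    (2/m!) F_m(t) after that pole satisfies an inequality whose homogeneous
    part is a contraction for a suitable weight and whose source term is
    |t + i pi|^(-m-1) + |t - i pi|^(-m-1).  For large m its
    iterates bound the remainder by twice the source ([remainder_le_poles]),
    which is exponentially smaller than the principal pole.

    For local uniformity, t itself is discontinuous across the negative axis,
    but the estimate only needs bounds on t, and these follow from bounds on
    |z| and |z - 1| alone, since Re u / |u| = (|z| - 1) / |z - 1|
    ([Re_uval], [away_strip]).

    The bound |u| < 1 for the branch that is positive on ]1, +oo[ amounts to
    Re (rt z) > 0, by the intermediate value theorem on a segment along which
    the real part of the branch cannot vanish ([Re_branch_gt0]). *)

(** * Type B Eulerian polynomials *)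

Section EulerianNumbers.
Variable K : comNzRingType.

Definition eulerian_coef (m k : nat) : K :=
  \sum_(i < k.+1) (-1) ^+ (k - i) *+ 'C(m.+1, k - i) * (2 * i + 1)%:R ^+ m.

Lemma eulerian_coef0 m : eulerian_coef m 0 = 1.
Proof.
by rewrite /eulerian_coef big_ord_recl big_ord0 addr0 subnn bin0 expr0 expr1n mul1r.
Qed.

(** Termwise: the terms with the same base 2i + 1 match by Pascal's rule and
    the absorption identity for binomial coefficients. *)
Lemma eulerian_coefS m k : eulerian_coef m.+1 k.+1 =
  (2 * k%:R + 3) * eulerian_coef m k.+1 +
  (2 * m%:R + 1 - 2 * k%:R) * eulerian_coef m k.
Proof.
rewrite /eulerian_coef big_ord_recr [in RHS]big_ord_recr /= !subnn !bin0 !expr0.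
rewrite mulrDr !mulr_sumr addrAC -big_split /=; congr (_ + _); last first.
  by rewrite !mul1r exprS; congr (_ * _); rewrite natrD natrM -natr1; ring.
apply: eq_bigr => i _; have ik : (i <= k)%N by rewrite -ltnS.
rewrite (subSn ik); set j := (k - i)%N.
have kE : (k%:R : K) = i%:R + j%:R by rewrite -natrD subnKC.
have E : (j.+1%:R * 'C(m.+1, j.+1)%:R : K) = (m%:R + 1 - j%:R) * 'C(m.+1, j)%:R.
  rewrite -natrM mul_bin_left natrM; case: (leqP j m.+1) => jm.
    by rewrite natrB// -natr1.
  by rewrite bin_small// !mulr0.
rewrite -(mulr_natr _ 'C(m.+2, j.+1)) -(mulr_natr _ 'C(m.+1, j.+1)).
rewrite -(mulr_natr _ 'C(m.+1, j)) kE binS natrD [_ ^+ m.+1]exprS (exprS _ j).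
have zE : ((2 * i + 1)%:R : K) = 2 * i%:R + 1 by rewrite natrD natrM.
move: E; rewrite {1}zE; set X := 'C(m.+1, j.+1)%:R; set Y := 'C(m.+1, j)%:R; rewrite -natr1 => E.
set s := (-1) ^+ j; set z := _%:R ^+ m.
apply/eqP; rewrite -subr_eq0; apply/eqP.
transitivity (2 * s * z * ((j%:R + 1) * X - (m%:R + 1 - j%:R) * Y)); first by ring.
by rewrite E subrr mulr0.
Qed.

(** The recurrence is valid past the degree as well, so that the vanishing of
    the coefficients beyond the degree propagates from m = 0. *)
Lemma eulerian_coef_gt m k : (m < k)%N -> eulerian_coef m k = 0.
Proof.
elim: m k => [|m IH] [|k]// mk; last first.
  by rewrite eulerian_coefS !IH ?mulr0 ?addr0// ltnW.
rewrite /eulerian_coef !big_ord_recr /= subnn subSnn bin0 bin1 !expr0 expr1.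
rewrite big1 ?add0r => [|i _]; first by ring.
by rewrite bin_small ?mulr0n ?mul0r// subSn ?ltnS ?subn_gt0// ltnW.
Qed.

Lemma coef_eulerianB m k : (eulerianB K m)`_k = eulerian_coef m k.
Proof.
by rewrite coef_poly ltnS; case: leqP => // /eulerian_coef_gt ->.
Qed.

Lemma eulerianB0 : eulerianB K 0 = 1.
Proof.
apply/polyP => -[|k]; rewrite coef_eulerianB coef1 ?eulerian_coef0//.
by rewrite eulerian_coef_gt.
Qed.

Lemma eulerianBS m : eulerianB K m.+1 =
  (1 + (2 * m + 1)%:R *: 'X) * eulerianB K m +
  2 *: ('X * (1 - 'X) * (eulerianB K m)^`()).
Proof.
apply/polyP => k; rewrite coef_eulerianB.
rewrite mulrDl mul1r !mulrBr mulr1 mulrBl !(coefD, coefZ, coefN).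
rewrite -scalerAl coefZ -(mulrA 'X 'X) !coefXM !coef_deriv.
case: k => [|[|k]] /=.
- by rewrite !coef_eulerianB !eulerian_coef0; ring.
- by rewrite !coef_eulerianB eulerian_coefS mulr1n natrD natrM; ring.
- rewrite !coef_eulerianB eulerian_coefS -!(mulr_natr (eulerian_coef _ _)).
  by rewrite natrD natrM -!natr1; ring.
Qed.

Lemma eulerianB_at1 m : (eulerianB K m).[1] = 2 ^+ m * m`!%:R.
Proof.
elim: m => [|m IH]; first by rewrite eulerianB0 hornerC mul1r.
rewrite eulerianBS !hornerE IH exprS factS natrM natrD natrM -[m.+1%:R]natr1 /=.
by ring.
Qed.

(** With w = coth t one has u = exp(-2t) = (w - 1) / (w + 1), and this is the
    homogenization of the Eulerian polynomial in w - 1 and w + 1: divided by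
    2^(m+1) sinh t, it is (-d/dt)^m (1 / (2 sinh t)) as a polynomial in
    coth t. *)
Definition coth_poly (m : nat) : {poly K} :=
  \sum_(k < m.+1) eulerian_coef m k *: (('X - 1) ^+ k * ('X + 1) ^+ (m - k)).

Lemma coth_poly0 : coth_poly 0 = 1.
Proof. by rewrite /coth_poly big_ord1 eulerian_coef0 scale1r mulr1. Qed.

(** The differential equations coth' = 1 - coth^2 and
    (1 / sinh)' = - coth / sinh, read on coefficients. *)
Lemma coth_polyS m :
  coth_poly m.+1 = 2 *: ('X * coth_poly m + ('X ^+ 2 - 1) * (coth_poly m)^`()).
Proof.
(* multiplying by X or differentiating the summand of index k and multiplying
   by X^2 - 1 gives a combination of T k and T k.+1 *)
pose T (k : nat) : {poly K} := ('X - 1) ^+ k * ('X + 1) ^+ (m.+1 - k).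
pose c1 k : K := (2 * k%:R + 1) * eulerian_coef m k.
pose c2 k : K := (2 * m%:R + 1 - 2 * k%:R) * eulerian_coef m k.
have -> : coth_poly m.+1 = \sum_(k < m.+1) c1 k *: T k + \sum_(k < m.+1) c2 k *: T k.+1.
  rewrite /coth_poly big_ord_recl eulerian_coef0 /=.
  under eq_bigr => i _.
    rewrite /bump leq0n add1n eulerian_coefS scalerDl; over.
  rewrite big_split addrA; congr (_ + _).
  rewrite [RHS]big_ord_recl /c1 eulerian_coef0; congr (_ + _).
    by rewrite /T mulr0 add0r mulr1.
  rewrite big_ord_recr /= eulerian_coef_gt// mulr0 scale0r addr0.
  apply: eq_bigr => i _; congr (_ *: _); rewrite /bump leq0n add1n -natr1.
  by congr (_ * _); ring.
rewrite /coth_poly raddf_sum [in RHS]mulr_sumr [X in 2 *: (_ + X)]mulr_sumr -!big_split scaler_sumr /=.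
apply: eq_bigr => i _; have im : (i <= m)%N by rewrite -ltnS.
have dX (p : {poly K}) k : p^`() = 1 -> p * (p ^+ k)^`() = p ^+ k *+ k.
  move=> p1; rewrite deriv_exp p1 mul1r mulrnAr; case: k => // k.
  by rewrite -exprS.
have dm : (('X - 1) ^+ i : {poly K})^`() * ('X - 1) = ('X - 1) ^+ i *+ i.
  by rewrite mulrC dX// derivB derivX derivC subr0.
have dp : (('X + 1) ^+ (m - i) : {poly K})^`() * ('X + 1) =
    ('X + 1) ^+ (m - i) *+ (m - i).
  by rewrite mulrC dX// derivD derivX derivC addr0.
rewrite derivZ derivM /c1 /c2 /T subSS (subSn im) (exprS (_ - _)) (exprS (_ + _)).
move: dm dp; set a := _ ^+ i; set c := _ ^+ (m - i) => dm dp.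
rewrite -!mul_polyC.
have -> : 'X * ((eulerian_coef m i)%:P * (a * c)) +
  ('X ^+ 2 - 1) * ((eulerian_coef m i)%:P * (a^`() * c + a * c^`())) =
  (eulerian_coef m i)%:P * ('X * a * c + (a^`() * ('X - 1)) * c * ('X + 1) +
     (c^`() * ('X + 1)) * a * ('X - 1)) by ring.
rewrite dm dp -(mulr_natr a) -(mulr_natr c) natrB//.
rewrite !(polyCM, polyCD, polyCB, rmorph1, rmorph_nat).
by ring.
Qed.

(** coth is odd, and each derivative flips the parity.  This is why the
    rational function of w in the statement is a polynomial in z = w^2 when m
    is odd, whatever the square root. *)
Lemma coth_poly_parity k : exists p q : {poly K},
  coth_poly (2 * k) = p \Po 'X^2 /\ coth_poly (2 * k).+1 = 'X * (q \Po 'X^2).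
Proof.
have odd_of m (p : {poly K}) : coth_poly m = p \Po 'X^2 ->
    coth_poly m.+1 =
    'X * ((2 *: p + 4 *: (('X - 1) * p^`())) \Po 'X^2).
  move=> E; rewrite coth_polyS E deriv_comp derivXn.
  rewrite !(comp_polyD, comp_polyB, comp_polyZ, comp_polyM, comp_polyX, comp_polyC).
  by rewrite -!mul_polyC expr1; ring.
have even_of m (q : {poly K}) : coth_poly m = 'X * (q \Po 'X^2) ->
    coth_poly m.+1 =
    (2 *: ('X * q + ('X - 1) * (q + 2 *: 'X * q^`()))) \Po 'X^2.
  move=> E; rewrite coth_polyS E derivM derivX mul1r deriv_comp derivXn.
  rewrite !(comp_polyD, comp_polyB, comp_polyZ, comp_polyM, comp_polyX, comp_polyC).
  by rewrite -!mul_polyC expr1; ring.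
elim: k => [|k [p [q [Ep Eq]]]].
  have E0 : coth_poly 0 = 1%:P \Po 'X^2 by rewrite coth_poly0 comp_polyC.
  by exists 1%:P; eexists; rewrite muln0; split; [exact: E0|exact: odd_of E0].
have E2 := even_of _ _ Eq; have E3 := odd_of _ _ E2.
by rewrite mulnS add2n; eexists; eexists; split; [exact: E2|exact: E3].
Qed.

End EulerianNumbers.

Lemma horner_coth_poly (K : fieldType) m (w : K) : w + 1 != 0 ->
  (coth_poly K m).[w] = (1 + w) ^+ m * (eulerianB K m).[(w - 1) / (w + 1)].
Proof.
move=> w1; rewrite /coth_poly horner_sum horner_poly mulr_sumr; apply: eq_bigr => i _.
have im : (i <= m)%N by rewrite -ltnS.
have -> : (1 + w) ^+ m = (w + 1) ^+ (m - i) * (w + 1) ^+ i.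
  by rewrite -exprD subnK// addrC.
rewrite !hornerE /= -/(eulerian_coef K m i) expr_div_n; field.
by rewrite expf_neq0.
Qed.

(** * The complex exponential on a horizontal strip *)
Section ComplexExp.
Variable R : realType.
Local Notation C := (R[i]).
Local Notation nm := (@Normc.normc R).

Lemma nm_ge0 (z : C) : 0 <= nm z. Proof. by case: z => a b; exact: sqrtr_ge0. Qed.
Lemma nmM (x y : C) : nm (x * y) = nm x * nm y. Proof. exact: Normc.normcM. Qed.
Lemma nmV (x : C) : nm x^-1 = (nm x)^-1. Proof. exact: Normc.normcV. Qed.
Lemma nm1 : nm 1 = 1. Proof. exact: Normc.normc1. Qed.
Lemma nm0 : nm 0 = 0. Proof. exact: Normc.normc0. Qed.
Lemma nmX (x : C) n : nm (x ^+ n) = nm x ^+ n.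
Proof. by elim: n => [|n IH]; rewrite ?nm1// !exprS nmM IH. Qed.
Lemma nmN (x : C) : nm (- x) = nm x. Proof. exact: normcN. Qed.
Lemma nmD (x y : C) : nm (x + y) <= nm x + nm y. Proof. exact: le_normcD. Qed.
Lemma nmBC (x y : C) : nm (x - y) = nm (y - x). Proof. by rewrite -nmN opprB. Qed.
Lemma nmB_ge (x y : C) : nm x - nm y <= nm (x - y).
Proof. by rewrite lerBlDr -{1}(subrK y x) nmD. Qed.
Lemma nm_eq0 (x : C) : (nm x == 0) = (x == 0).
Proof. by apply/eqP/eqP => [/Normc.eq0_normc//|->]; rewrite nm0. Qed.
Lemma nm_gt0 (x : C) : (0 < nm x) = (x != 0).
Proof. by rewrite lt_def nm_ge0 nm_eq0 andbT. Qed.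
Lemma nm_sqr (z : C) : nm z ^+ 2 = complex.Re z ^+ 2 + complex.Im z ^+ 2.
Proof. by case: z => a b; rewrite /= sqr_sqrtr// addr_ge0 ?sqr_ge0. Qed.
Lemma nm_real (x : R) : nm x%:C = `|x|.
Proof. by rewrite /= expr0n addr0 sqrtr_sqr. Qed.
Lemma nm_nat (n : nat) : nm n%:R = n%:R.
Proof. by rewrite -(rmorph_nat (real_complex R)) nm_real ger0_norm. Qed.
Lemma nm_Re (z : C) : `|complex.Re z| <= nm z.
Proof.
rewrite -(ler_pXn2r (_ : 0 < 2)%N) ?nnegrE ?normr_ge0 ?nm_ge0//.
by rewrite real_normK ?num_real// nm_sqr lerDl sqr_ge0.
Qed.
Lemma nm_Im (z : C) : `|complex.Im z| <= nm z.
Proof.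
rewrite -(ler_pXn2r (_ : 0 < 2)%N) ?nnegrE ?normr_ge0 ?nm_ge0//.
by rewrite real_normK ?num_real// nm_sqr lerDr sqr_ge0.
Qed.
Lemma nm_le_ReIm (z : C) : nm z <= `|complex.Re z| + `|complex.Im z|.
Proof.
rewrite -(ler_pXn2r (_ : 0 < 2)%N) ?nnegrE ?addr_ge0 ?nm_ge0//.
rewrite nm_sqr sqrrD !real_normK ?num_real// lerD2r lerDl.
by rewrite mulrn_wge0// mulr_ge0.
Qed.

Definition Cexp (z : C) : C :=
  (expR (complex.Re z) * cos (complex.Im z)) +i*
  (expR (complex.Re z) * sin (complex.Im z)).

Lemma CexpD x y : Cexp (x + y) = Cexp x * Cexp y.
Proof.
case: x y => [a b] [c d]; rewrite /Cexp /= expRD cosD sinD; simpc.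
by congr (_ +i* _); ring.
Qed.

Lemma Cexp0 : Cexp 0 = 1.
Proof. by rewrite /Cexp /= expR0 cos0 sin0 mulr1 mulr0. Qed.

Lemma nm_Cexp z : nm (Cexp z) = expR (complex.Re z).
Proof.
rewrite /Cexp /= !exprMn -mulrDr cos2Dsin2 mulr1 sqrtr_sqr.
by rewrite ger0_norm ?expR_ge0.
Qed.

Lemma Cexp_neq0 z : Cexp z != 0.
Proof. by rewrite -nm_eq0 nm_Cexp gt_eqF ?expR_gt0. Qed.

Lemma CexpMn z n : Cexp (n%:R * z) = Cexp z ^+ n.
Proof.
elim: n => [|n IH]; first by rewrite mul0r Cexp0.
by rewrite -natr1 mulrDl mul1r CexpD IH exprSr.
Qed.

Lemma expR_sub1_bounds (x : R) : x <= expR x - 1 <= x * expR x.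
Proof.
have h1 := expR_ge1Dx x; have h2 := expR_ge1Dx (- x).
have p := expR_gt0 x.
have e : expR x * expR (- x) = 1 by rewrite expRxMexpNx_1.
apply/andP; split; first by lra.
have : expR x * (1 - x) <= expR x * expR (- x) by rewrite ler_wpM2l// ltW.
by rewrite e; lra.
Qed.

Lemma MVT_from0 (f df : R -> R) (y : R) : 0 <= y ->
  (forall x : R, is_derive x 1 f (df x)) ->
  exists2 c, 0 <= c <= y & f y - f 0 = df c * y.
Proof.
move=> y0 fdf.
have fc : {within `[0, y], continuous f}.
  by apply: derivable_within_continuous => x _; have [] := fdf x.
have [c] := MVT_segment y0 (fun x _ => fdf x) fc.
by rewrite in_itv /= subr0 => c0y E; exists c.
Qed.

Lemma sin_le (y : R) : 0 <= y -> sin y <= y.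
Proof.
move=> y0.
have dF (z : R) : is_derive z 1 (fun y : R => y - sin y) (1 - cos z).
  by apply: is_derive_eq.
have [c _] := MVT_from0 y0 dF.
by rewrite sin0 !subr0 => E; rewrite -subr_ge0 E mulr_ge0// subr_ge0 cos_le1.
Qed.

Lemma norm_sin_le (y : R) : `|sin y| <= `|y|.
Proof.
wlog y0 : y / 0 <= y => [H|].
  have [/H//|/ltW y0] := leP 0 y.
  by rewrite -normrN -sinN -(normrN y); apply: H; rewrite oppr_ge0.
have [ypi|ypi] := leP y pi.
  by rewrite !ger0_norm ?sin_le// sin_ge0_pi ?y0.
apply: le_trans (sin_max _) _; rewrite ger0_norm//.
by have := pi_ge2 R; lra.
Qed.

Lemma onem_cos (y : R) : 1 - cos y = 2 * sin (y / 2) ^+ 2.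
Proof.
have {1}-> : y = (y / 2) *+ 2 by rewrite -mulr_natr divfK.
by rewrite cos_mulr2n sin2cos2 -mulr_natr; ring.
Qed.

Lemma onem_cos_le (y : R) : 1 - cos y <= y ^+ 2 / 2.
Proof.
rewrite onem_cos; have := norm_sin_le (y / 2).
rewrite -(ler_pXn2r (_ : 0 < 2)%N) ?nnegrE// !real_normK ?num_real//.
by rewrite expr_div_n; lra.
Qed.

Lemma sub_sin_le (y : R) : `|y| <= pi -> `|y - sin y| <= pi * y ^+ 2.
Proof.
wlog y0 : y / 0 <= y => [H|].
  have [/H//|/ltW y0 yp] := leP 0 y.
  have -> : y - sin y = - (- y - sin (- y)) by rewrite sinN; ring.
  rewrite normrN -sqrrN.
  by apply: H; rewrite ?oppr_ge0 ?normrN.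
rewrite (ger0_norm y0) => ypi.
rewrite ger0_norm ?subr_ge0 ?sin_le//.
have dF (z : R) : is_derive z 1 (fun y : R => y - sin y) (1 - cos z).
  by apply: is_derive_eq.
have [c cy] := MVT_from0 y0 dF.
rewrite sin0 !subr0 => ->.
move: cy => /andP[c0 cy].
have : 1 - cos c <= y ^+ 2 / 2.
  by apply: le_trans (onem_cos_le c) _; rewrite ler_pM2r ?invr_gt0// ler_pXn2r.
have : y ^+ 2 <= pi * y by rewrite expr2 ler_wpM2r.
move=> h1 h2; rewrite (expr2 y) mulrA ler_wpM2r//.
have : 0 <= pi * y by rewrite mulr_ge0// pi_ge0.
lra.
Qed.

(** From tan x >= x at x = s/2: sin s = 2 sin x cos x >= s cos^2 x, and
    cos^2 x >= 1/2. *)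
Lemma sin_ge_half (s : R) : 0 <= s <= pi / 2 -> s / 2 <= sin s.
Proof.
have cosm (x : R) : 0 <= x <= pi -> x * cos x <= sin x.
  move=> /andP[x0 xpi].
  have dF (z : R) : is_derive z 1 (fun y : R => sin y - y * cos y) (z * sin z).
    by apply: is_derive_eq; rewrite /GRing.scale /=; ring.
  have [c cx] := MVT_from0 x0 dF.
  rewrite sin0 mul0r !subr0 => E; rewrite -subr_ge0 E.
  move: cx => /andP[c0 cx].
  by rewrite !mulr_ge0// sin_ge0_pi// c0 (le_trans cx).
move=> /andP[s0 spi]; have p := pi_gt0 R.
have -> : sin s = 2 * (cos (s / 2) * sin (s / 2)).
  have {1}-> : s = (s / 2) *+ 2 by rewrite -mulr_natr divfK.
  by rewrite sin_mulr2n -mulr_natr; ring.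
have := cosm (s / 2); have : 0 <= cos s.
  by apply: cos_ge0_pihalf; apply/andP; split; lra.
have -> : cos s = 2 * cos (s / 2) ^+ 2 - 1.
  have {1}-> : s = (s / 2) *+ 2 by rewrite -mulr_natr divfK.
  by rewrite cos_mulr2n -mulr_natr; ring.
have c0 : 0 <= cos (s / 2).
  by apply: cos_ge0_pihalf; apply/andP; split; lra.
move=> c2 h; have {h} : s / 2 * cos (s / 2) <= sin (s / 2).
  by apply: h; apply/andP; split; lra.
move=> /(ler_wpM2l c0); move: c2.
set c := cos _; set S := sin _ => c2 h.
have : s * (2 * c ^+ 2 - 1) >= 0 by rewrite mulr_ge0.
nra.
Qed.

(** Only the existence of a constant matters; the one given is generous. *)
Lemma Cexp_taylor (M : R) : exists2 K, 0 <= K & forall z : C,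
  `|complex.Re z| <= M -> `|complex.Im z| <= pi ->
  nm (Cexp z - 1 - z) <= K * nm z ^+ 2.
Proof.
have p0 := pi_ge0 R.
exists (4 * (expR M * (1 + M ^+ 2 + pi) + (1 + `|M|) + pi)).
  have ? := expR_ge0 M; have ? := sqr_ge0 M; have ? := normr_ge0 M; 
  apply: mulr_ge0 => //; apply: addr_ge0 => //; apply: addr_ge0; last by lra.
  by apply: mulr_ge0 => //; lra.
move=> z; have [a [b ->]] : exists a b, z = a +i* b by case: z => a b; exists a, b.
move=> aM bpi; rewrite nm_sqr; apply: le_trans (nm_le_ReIm _) _.
move: aM bpi => /= aM bpi.
have M0 : 0 <= M by apply: le_trans aM.
rewrite (ger0_norm M0).
have ea : `|expR a - 1| <= `|a| * expR M.
  have /andP[h1 h2] := expR_sub1_bounds a.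
  have eM : expR a <= expR M by rewrite ler_expR (le_trans _ aM)// ler_norm.
  have e0 := expR_gt0 a.
  have eM1 : 1 <= expR M by have := expR_ge1Dx M; lra.
  have [a0|a0] := leP 0 a.
    by rewrite !ger0_norm//; nra.
  by rewrite !ler0_norm//; nra.
have ea2 : `|expR a - 1 - a| <= a ^+ 2 * expR M.
  have /andP[h1 h2] := expR_sub1_bounds a.
  rewrite ger0_norm ?subr_ge0//.
  have : expR a - 1 - a <= `|a| * `|expR a - 1|.
    by rewrite -normrM (le_trans _ (ler_norm _))//; nra.
  move/le_trans; apply.
  by rewrite -real_normK ?num_real// expr2 -mulrA ler_wpM2l.
have cb := onem_cos_le b; have cb1 := cos_le1 b.
have sb := sub_sin_le bpi.
have sb1 := norm_sin_le b.
have eM := expR_gt0 M.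
have cm := cos_max b.
have -> : expR a * cos b - 1 - a = (expR a - 1 - a) * cos b - (1 + a) * (1 - cos b) by ring.
have -> : expR a * sin b - 0 - b = (expR a - 1) * sin b - (b - sin b) by ring.
have h1 : `|(expR a - 1 - a) * cos b| <= a ^+ 2 * expR M.
  by rewrite normrM -[leRHS]mulr1 ler_pM.
have h2 : `|(1 + a) * (1 - cos b)| <= (1 + M) * (b ^+ 2 / 2).
  rewrite normrM ler_pM//; last by rewrite ger0_norm ?subr_ge0.
  by rewrite (le_trans (ler_normD _ _))// normr1 lerD2l.
have h3 : `|(expR a - 1) * sin b| <= `|a| * expR M * `|b| by rewrite normrM ler_pM.
have h4 : `|a| * `|b| <= a ^+ 2 + b ^+ 2.
  rewrite -(real_normK (num_real a)) -(real_normK (num_real b)).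
  by have := sqr_ge0 (`|a| - `|b|); have := sqr_ge0 (`|a| + `|b|); nra.
apply: le_trans (lerD (ler_normB _ _) (ler_normB _ _)) _.
have := sqr_ge0 a; have := sqr_ge0 b.
have : `|a| * expR M * `|b| <= expR M * (a ^+ 2 + b ^+ 2).
  by rewrite mulrAC mulrC ler_wpM2l// ltW.
move: h1 h2 h3 sb {h4 ea ea2 cb cb1 sb1 cm}.
set A := a ^+ 2; set B := b ^+ 2; set E := expR M.
set P := pi => h1 h2 h3 sb h4 B0 A0.
have : 0 <= M ^+ 2 by exact: sqr_ge0.
set N := M ^+ 2 => N0.
have E0 : 0 <= E by exact: ltW.
have ? : 0 <= E * A by exact: mulr_ge0.
have ? : 0 <= E * B by exact: mulr_ge0.
have ? : 0 <= E * A * N by do ?[done|apply: mulr_ge0].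
have ? : 0 <= E * B * N by do ?[done|apply: mulr_ge0].
have ? : 0 <= E * A * P by do ?[done|apply: mulr_ge0].
have ? : 0 <= E * B * P by do ?[done|apply: mulr_ge0].
have ? : 0 <= A * P by do ?[done|apply: mulr_ge0].
have ? : 0 <= B * P by do ?[done|apply: mulr_ge0].
have ? : 0 <= A * M by do ?[done|apply: mulr_ge0].
have ? : 0 <= B * M by do ?[done|apply: mulr_ge0].
nra.
Qed.

(** The zeros of exp z - 1 other than 0 are at distance at least pi from the
    closed strip |Im z| <= pi.  Quantitatively
    |exp z - 1|^2 = (exp x - 1)^2 + 4 exp x sin^2 (y/2). *)
Lemma Cexp_sub1_ge (M : R) (z : C) :
  `|complex.Re z| <= M -> `|complex.Im z| <= pi ->
  expR (- M) / 2 * nm z <= nm (Cexp z - 1).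
Proof.
have [a [b ->]] : exists a b, z = a +i* b by case: z => a b; exists a, b.
move=> aM' bpi'; have aM : `|a| <= M := aM'; have bpi : `|b| <= pi := bpi'.
have M0 : 0 <= M by apply: le_trans aM.
rewrite -(ler_pXn2r (_ : 0 < 2)%N) ?nnegrE ?mulr_ge0 ?expR_ge0 ?nm_ge0//.
rewrite exprMn !nm_sqr /=.
have -> : (expR a * cos b - 1) ^+ 2 + (expR a * sin b - 0) ^+ 2 =
  (expR a - 1) ^+ 2 + 2 * expR a * (1 - cos b) + (expR a) ^+ 2 * ((cos b ^+ 2 + sin b ^+ 2) - 1) by ring.
rewrite cos2Dsin2 subrr mulr0 addr0 onem_cos.
set k := expR (- M).
have k0 : 0 < k by exact: expR_gt0.
have k1 : k <= 1 by rewrite expR_le1 oppr_le0.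
have ka : k <= expR a.
  by rewrite ler_expR; move: aM; rewrite ler_norml => /andP[].
have ha : k ^+ 2 * a ^+ 2 <= (expR a - 1) ^+ 2.
  rewrite -exprMn -(real_normK (num_real (expR a - 1))) -real_normK ?num_real//.
  rewrite ler_pXn2r ?nnegrE// normrM ger0_norm ?(ltW k0)//.
  have /andP[h1 h2] := expR_sub1_bounds a.
  have [a0|a0] := leP 0 a.
    by rewrite !ger0_norm//; nra.
  by rewrite !ler0_norm//; nra.
have hb : b ^+ 2 / 16 <= sin (b / 2) ^+ 2.
  have -> : b ^+ 2 / 16 = (`|b| / 4) ^+ 2.
    by rewrite expr_div_n real_normK ?num_real//; congr (_ / _); ring.
  rewrite -(real_normK (num_real (sin _))) ler_pXn2r ?nnegrE ?divr_ge0//.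
  have : `|b| / 2 / 2 <= sin (`|b| / 2).
    by apply: sin_ge_half; rewrite divr_ge0//= ler_pM2r ?invr_gt0.
  have -> : `|b| / 2 / 2 = `|b| / 4 by field.
  move=> /le_trans; apply.
  have [b0|b0] := leP 0 b; first by rewrite (ger0_norm b0) ler_norm.
  by rewrite (ltr0_norm b0) mulNr sinN -normrN ler_norm.
have ? := sqr_ge0 a; have ? := sqr_ge0 b.
have : k * (b ^+ 2 / 16) <= expR a * sin (b / 2) ^+ 2.
  by rewrite ler_pM ?(ltW k0)// divr_ge0.
have : 0 <= (k - k ^+ 2) * b ^+ 2 by rewrite mulr_ge0// subr_ge0 expr2; nra.
have : 0 <= k ^+ 2 * a ^+ 2 by rewrite mulr_ge0// sqr_ge0.
rewrite expr_div_n.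
lra.
Qed.

End ComplexExp.

(** * The odd power generating function and its triplication formula *)
Section HornerDerive.
Variable K : numFieldType.
Lemma is_derive_horner (p : {poly K}) (x : K) :
  is_derive (x : K^o) 1 (horner p : K^o -> K^o) p^`().[x].
Proof.
elim/poly_ind: p => [|p r ih].
  have -> : horner (0 : {poly K}) = cst 0 by apply/funext => y; rewrite horner0.
  rewrite deriv0 horner0; exact: is_derive_cst.
have -> : horner (p * 'X + r%:P) =
   (horner p : K^o -> K^o) * (id : K^o -> K^o) + (cst r : K^o -> K^o).
  by apply/funext => y /=; rewrite !(hornerE, fctE).
apply: is_derive_eq.
rewrite /GRing.scale /= derivD derivM derivX derivC !hornerE /=; ring.
Qed.

Lemma continuous_horner_num (p : {poly K}) : continuous (horner p : K^o -> K^o).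
Proof.
move=> /= x; apply/differentiable_continuous.
by apply/derivable1_diffP; have [] := is_derive_horner p x.
Qed.
End HornerDerive.

Section FunctionalEquation.
Variable K : numFieldType.

(** The sum of the (2k+1)^m q^(2k+1), continued as a rational function. *)
Definition oddgf (m : nat) (q : K) : K :=
  q * (eulerianB K m).[q ^+ 2] / (1 - q ^+ 2) ^+ m.+1.

Let num (m : nat) : {poly K} := 'X * (eulerianB K m \Po 'X^2).

(** The operator q d/dq multiplies q^(2k+1) by 2k+1, so it maps [oddgf m] to
    [oddgf m.+1]; on the numerators this is the recurrence [eulerianBS].  The
    composition with a polynomial is built in to provide the chain rule. *)
Lemma is_derive_oddgf_comp m (g : {poly K}) (q : K) :
  g.[q] != 0 -> g.[q] ^+ 2 != 1 ->
  is_derive (q : K^o) 1 (fun q => oddgf m g.[q] : K^o)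
    (g^`().[q] * (oddgf m.+1 g.[q] / g.[q])).
Proof.
move=> g0 g1.
have D0 : 1 - g.[q] ^+ 2 != 0 by rewrite subr_eq0 eq_sym.
pose N := num m \Po g; pose D := ((1 - 'X^2) ^+ m.+1) \Po g.
have DE x : D.[x] = (1 - g.[x] ^+ 2) ^+ m.+1.
  by rewrite horner_comp !hornerE.
have NE x : N.[x] = g.[x] * (eulerianB K m).[g.[x] ^+ 2].
  by rewrite horner_comp hornerM hornerX horner_comp hornerXn.
have Dq : D.[q] != 0 by rewrite DE expf_neq0.
have -> : (fun q => oddgf m g.[q] : K^o) =
    (horner N : K^o -> K^o) * (fun x : K^o => (horner D x)^-1 : K^o).
  by apply/funext => x; rewrite /oddgf fctE -DE -NE.
have dN := is_derive_horner N q; have dD := is_derive_horner D q.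
have dV : is_derive (q : K^o) 1 (fun x : K^o => (horner D x)^-1 : K^o)
    (- D.[q] ^- 2 * D^`().[q]).
  apply: DeriveDef; first by apply: derivableV => //; case: dD.
  by rewrite deriveV// derive_val.
have H := is_deriveM dN dV; apply: (is_derive_eq H).
rewrite /GRing.scale /= DE NE.
rewrite /N /D !deriv_comp !hornerM !horner_comp /num derivM derivX mul1r deriv_comp derivXn.
rewrite deriv_exp derivB derivXn derivC !hornerE /= !horner_comp !hornerE /=.
rewrite /oddgf eulerianBS !hornerE /=.
set G := g.[q]; set G' := g^`().[q].
set B := (eulerianB K m).[_]; set B' := (eulerianB K m)^`().[_].
have -> : ('X^1 *- 2 * (1 - 'X^2) ^+ m *+ m.+1).[G] =
    - (2 * G) * (1 - G ^+ 2) ^+ m * (m%:R + 1).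
  rewrite hornerMn hornerM hornerN hornerMn hornerXn horner_exp !hornerE /=.
  by rewrite -mulr_natr -natr1 expr1; ring.
rewrite (exprS _ m.+1) (exprS _ m) expr1 natrD natrM.
have S0 : (1 - G ^+ 2) ^+ m != 0 by rewrite expf_neq0.
move: S0 D0; set S := _ ^+ m; rewrite -/G => S0 D0.
by field; rewrite g0 S0 D0.
Qed.

Lemma is_derive_oddgf m (g : {poly K}) (h : K -> K) (q : K) :
  h =1 horner g -> h q != 0 -> h q ^+ 2 != 1 ->
  is_derive (q : K^o) 1 (fun x => oddgf m (h x) : K^o)
    (g^`().[q] * (oddgf m.+1 (h q) / h q)).
Proof. by move=> /funext -> ; exact: is_derive_oddgf_comp. Qed.

(** Averaging over the cube roots of unity keeps the odd powers q^(2k+1) with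
    3 | 2k+1.  As an identity between rational functions: check m = 0, then
    apply q d/dq, which yields a factor 3 on the right-hand side. *)
Lemma oddgf_triple (z : K) (hz : z ^+ 2 + z + 1 = 0) m (q : K) :
  q != 0 -> q ^+ 6 != 1 ->
  oddgf m q + oddgf m (z * q) + oddgf m (z ^+ 2 * q) =
  3 ^+ m.+1 * oddgf m (q ^+ 3).
Proof.
have z2 : z ^+ 2 = - 1 - z.
  by transitivity (- 1 - z + (z ^+ 2 + z + 1)); [ring|rewrite hz addr0].
have z3 : z ^+ 3 = 1 by rewrite exprS z2 mulrBr mulrN1 -expr2 z2; ring.
have z0 : z != 0 by apply/eqP => z0; move: z3; rewrite z0 expr0n /= => /esym/eqP; rewrite oner_eq0.
have zq2 (x : K) : (z * x) ^+ 2 = (- 1 - z) * x ^+ 2 by rewrite exprMn z2.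
have z2q2 (x : K) : (z ^+ 2 * x) ^+ 2 = z * x ^+ 2.
  by rewrite exprMn -exprM (_ : 2 * 2 = 3 + 1)%N// exprD z3 mul1r.
(* the product over the two nontrivial cube roots of unity *)
have fE (x : K) : (1 - (z * x) ^+ 2) * (1 - (z ^+ 2 * x) ^+ 2) = 1 + x ^+ 2 + x ^+ 4.
  rewrite zq2 z2q2; transitivity (1 + x ^+ 2 - (z ^+ 2 + z) * x ^+ 4); first by ring.
  by rewrite z2; ring.
have prodE (x : K) : (1 - x ^+ 2) * ((1 - (z * x) ^+ 2) * (1 - (z ^+ 2 * x) ^+ 2)) = 1 - x ^+ 6.
  by rewrite fE; ring.
have ne (x : K) : x ^+ 6 != 1 ->
    [/\ x ^+ 2 != 1, (z * x) ^+ 2 != 1, (z ^+ 2 * x) ^+ 2 != 1 & (x ^+ 3) ^+ 2 != 1].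
  move=> x6; rewrite -exprM; split=> //; apply: contra_neq x6 => E; apply/eqP;
  by rewrite -subr_eq0 -opprB oppr_eq0 -prodE E subrr ?(mul0r, mulr0).
elim: m q => [|m IH] q q0 q6.
  have [n1 n2 n3 n4] := ne q q6.
  rewrite /oddgf eulerianB0 !hornerC !expr1 !mulr1.
  move: n1 n2 n3 (prodE q); rewrite -![_ == 1]subr_eq0 -![_ - 1]opprB !oppr_eq0.
  move=> n1 n2 n3 pE.
  rewrite -addrA (addf_div _ _ n2 n3).
  have -> : z * q * (1 - (z ^+ 2 * q) ^+ 2) + z ^+ 2 * q * (1 - (z * q) ^+ 2) =
     - q * (1 - q ^+ 2).
    rewrite zq2 z2q2.
    transitivity (- q * (1 - q ^+ 2) + (z ^+ 2 + z + 1) * (q + q ^+ 3 * (z - 1))); last first.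
      by rewrite hz mul0r addr0.
    by ring.
  rewrite (addf_div _ _ n1 (mulf_neq0 n2 n3)) pE.
  by rewrite -exprM mulrA; congr (_ / _); rewrite fE; ring.
have [n1 n2 n3 n4] := ne q q6.
have d1 := @is_derive_oddgf m 'X id q (fun x => esym (hornerX x)) q0 n1.
have zE (c x : K) : c * x = (c *: 'X).[x] by rewrite hornerZ hornerX.
have d2 := @is_derive_oddgf m _ _ q (zE z) (mulf_neq0 z0 q0) n2.
have d3 := @is_derive_oddgf m _ _ q (zE (z ^+ 2)) (mulf_neq0 (expf_neq0 2 z0) q0) n3.
have d4 := @is_derive_oddgf m 'X^3 (fun x => x ^+ 3) q
  (fun x => esym (hornerXn x 3)) (expf_neq0 3 q0) n4.
have dr := @is_deriveZ _ _ _ _ (3 ^+ m.+1) _ _ _ d4.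
have dlh := is_deriveD (is_deriveD d1 d2) d3.
have nr : \forall x \near (q : K^o), x != 0 /\ x ^+ 6 != 1.
  have cp : horner ('X * ('X^6 - 1)) x @[x --> (q : K^o)] --> (('X * ('X^6 - 1)).[q] : K^o).
    exact: continuous_horner_num.
  have := cvgr_neq0 _ cp.
  rewrite !hornerE mulf_eq0 subr_eq0 negb_or q0 q6 => /(_ (nbhs_filter _) isT).
  apply: filterS => x; rewrite !hornerE mulf_eq0 subr_eq0 negb_or.
  by move=> /andP[].
have [_ E1] := @near_eq_is_derive _ _ _ _
  (3 ^+ m.+1 *: (fun x => oddgf m (x ^+ 3) : K^o)) _ _ _
  (filterS (fun x (hx : x != 0 /\ x ^+ 6 != 1) => IH x hx.1 hx.2) nr) dlh.
case: dr => _; rewrite E1 /GRing.scale /= derivXn !derivZ derivX !hornerZ hornerMn hornerXn hornerC.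
set x1 := oddgf _ q; set x2 := oddgf _ (z * q); set x3 := oddgf _ (z ^+ 2 * q).
set x4 := oddgf _ _ => E.
have : (x1 + x2 + x3) / q = (3 ^+ m.+2 * x4) / q.
  transitivity (1 * (x1 / q) + z * 1 * (x2 / (z * q)) + z ^+ 2 * 1 * (x3 / (z ^+ 2 * q))).
    by field; rewrite z0 q0.
  by rewrite E (exprS _ m.+1); field; rewrite q0.
by move/(mulIf (invr_neq0 q0)).
Qed.
End FunctionalEquation.

(** The principal pole t^(-n) solves the triplication formula up to the poles
    a^(-n) and b^(-n); the case of interest is a = t + i pi, b = t - i pi. *)
Lemma subr_poles_triple (K : numFieldType) n (L1 L2 L3 t a b : K) :
  3 ^- n * (L1 - L2 - L3) - t ^- n =
  3 ^- n * (L1 - (t / 3) ^- n - (L2 - (a / 3) ^- n) - (L3 - (b / 3) ^- n))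
  - a ^- n - b ^- n.
Proof.
have P0 : (3 : K) ^+ n != 0 by rewrite expf_neq0 ?pnatr_eq0.
have h (x : K) : 3 ^- n * (3 ^+ n / x) = x^-1 by rewrite mulKf.
by rewrite !expr_div_n !invf_div !mulrBr !h; ring.
Qed.

(** * The exponential variable and the size of the remainder *)
Section ExponentialVariable.
Variable R : realType.
Local Notation C := (R[i]).
Local Notation nm := (@Normc.normc R).

Definition i_pi : C := 0 +i* pi.

Lemma Cexp_i_pi : Cexp i_pi = -1.
Proof. by rewrite /Cexp /= expR0 cospi sinpi mulr0 mul1r; apply/eqP; rewrite eq_complex /= oppr0 !eqxx. Qed.

Lemma oppr_Cexp x : - Cexp x = Cexp (x + i_pi).
Proof. by rewrite CexpD Cexp_i_pi mulrN1. Qed.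

Lemma Cexp_neq1 (z : C) : z != 0 -> `|complex.Im z| <= pi -> Cexp z != 1.
Proof.
move=> z0 zpi; rewrite -subr_eq0 -nm_gt0.
apply: lt_le_trans (Cexp_sub1_ge (lexx _) zpi).
by rewrite mulr_gt0 ?nm_gt0// divr_gt0// expR_gt0.
Qed.

Lemma oddgfN m (q : C) : oddgf m (- q) = - oddgf m q.
Proof. by rewrite /oddgf sqrrN !mulNr. Qed.

(** Normalized so that the principal part at 0 is t^(-m-1). *)
Definition oddexp (m : nat) (t : C) : C := 2 / m`!%:R * oddgf m (Cexp (- t)).

(** The cube root of unity is exp(2 i pi/3); the shifts by 2 i pi/3 and
    4 i pi/3 are brought back to shifts by - i pi/3 and i pi/3 by means of the
    period i pi, which costs a sign since [oddgf] is odd. *)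
Lemma oddexp_triple m (t : C) : t != 0 -> `|complex.Im t| <= pi / 2 ->
  oddexp m t = (3 ^+ m.+1)^-1 *
    (oddexp m (t / 3) - oddexp m ((t + i_pi) / 3) - oddexp m ((t - i_pi) / 3)).
Proof.
move=> t0 tpi; pose q := Cexp (- (t / 3)); pose z := Cexp (2 * i_pi / 3).
have three0 : (3 : C) != 0 by rewrite pnatr_eq0.
have q3 : q ^+ 3 = Cexp (- t) by rewrite -CexpMn; congr Cexp; field.
have hz : z ^+ 2 + z + 1 = 0.
  have z1 : z - 1 != 0.
    rewrite subr_eq0; apply: Cexp_neq1.
      rewrite mulf_neq0 ?invr_neq0// mulf_neq0 ?pnatr_eq0//.
      by rewrite eq_complex /= eqxx /= gt_eqF// pi_gt0.
    have -> : complex.Im (2 * i_pi / 3) = 2 / 3 * pi.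
      have -> : 2 * i_pi / 3 = (2 / 3)%:C * i_pi by rewrite rmorphM fmorphV !rmorph_nat; ring.
      by rewrite /= !(mul0r, mulr0, addr0).
    have p := pi_ge0 R.
    by rewrite ger0_norm; lra.
  apply: (mulIf z1); rewrite mul0r.
  transitivity (z ^+ 3 - 1); first by ring.
  rewrite -CexpMn (_ : 3%:R * _ = i_pi + i_pi); last by field.
  by rewrite CexpD Cexp_i_pi mulrNN mulr1 subrr.
have E2 : z * q = - Cexp (- ((t + i_pi) / 3)).
  rewrite -CexpD oppr_Cexp; congr Cexp; by field.
have E3 : z ^+ 2 * q = - Cexp (- ((t - i_pi) / 3)).
  rewrite -CexpMn -CexpD oppr_Cexp; congr Cexp; by field.
have q6 : q ^+ 6 != 1.
  rewrite (_ : 6 = 3 * 2)%N// exprM q3 -CexpMn; apply: Cexp_neq1.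
    by rewrite mulrN oppr_eq0 mulf_neq0 ?pnatr_eq0.
  have -> : complex.Im (2%:R * - t) = - (2 * complex.Im t).
    have -> : 2%:R * - t = - (2%:R%:C * t) by rewrite rmorph_nat mulrN.
    by case: (t) => a b /=; ring.
  by rewrite normrN normrM ger0_norm//; lra.
have := oddgf_triple hz m (Cexp_neq0 _) q6.
rewrite E2 E3 !oddgfN q3 /oddexp => E.
by rewrite -!mulrBr E [RHS]mulrCA mulKf// expf_neq0.
Qed.

Variable M : R.
(** The rectangle stays away from the horizontal lines Im t = pi/2 and
    Im t = - pi/2 by d.  The origin is removed: it is the pole. *)
Definition strip (d : R) (t : C) :=
  [/\ t != 0, `|complex.Re t| <= M & `|complex.Im t| <= pi / 2 - d].

(** The estimate f(t) = c + O(t), uniform on the whole rectangle and not just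
    near 0. *)
Definition linear0 (f : C -> C) (c : C) :=
  exists2 Q : R, 0 <= Q & forall t, strip 0 t -> nm (f t - c) <= Q * nm t.

Lemma strip_bound t : strip 0 t -> nm t <= `|M| + pi.
Proof.
rewrite /strip subr0 => -[_ h1 h2]; apply: le_trans (nm_le_ReIm _) _.
have := pi_gt0 R; have := ler_norm M; lra.
Qed.

Lemma linear0_cst c : linear0 (fun=> c) c.
Proof. by exists 0 => // t _; rewrite subrr nm0 mul0r. Qed.

Lemma linear0D f g a b : linear0 f a -> linear0 g b ->
  linear0 (fun t => f t + g t) (a + b).
Proof.
move=> [Q Q0 fQ] [P P0 gP]; exists (Q + P); first exact: addr_ge0.
move=> t ht; rewrite mulrDl opprD addrACA.
by apply: le_trans (nmD _ _) _; rewrite lerD ?fQ ?gP.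
Qed.

Lemma linear0M f g a b : linear0 f a -> linear0 g b ->
  linear0 (fun t => f t * g t) (a * b).
Proof.
move=> [Q Q0 fQ] [P P0 gP].
pose L := `|M| + (pi : R).
have L0 : 0 <= L by rewrite addr_ge0 ?pi_ge0.
exists ((nm a + Q * L) * P + Q * nm b).
  by rewrite !addr_ge0 ?mulr_ge0 ?addr_ge0 ?nm_ge0 ?mulr_ge0.
move=> t ht.
have -> : f t * g t - a * b = f t * (g t - b) + (f t - a) * b by ring.
apply: le_trans (nmD _ _) _; rewrite !nmM mulrDl lerD//; last first.
  by rewrite mulrAC ler_wpM2r ?nm_ge0 ?fQ.
rewrite -mulrA ler_pM ?nm_ge0 ?gP//.
have -> : f t = a + (f t - a) by ring.
apply: le_trans (nmD _ _) _; rewrite lerD2l.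
by apply: le_trans (fQ _ ht) _; rewrite ler_wpM2l ?strip_bound.
Qed.

Lemma linear0X f a n : linear0 f a -> linear0 (fun t => f t ^+ n) (a ^+ n).
Proof.
move=> h; elim: n => [|n IH]; first exact: (linear0_cst 1).
by have := linear0M h IH; under eq_fun do rewrite -exprS; rewrite exprS.
Qed.

Lemma linear0_horner (p : {poly C}) f a : linear0 f a ->
  linear0 (fun t => p.[f t]) p.[a].
Proof.
move=> h; elim/poly_ind: p => [|p c IH].
  under eq_fun do rewrite horner0; rewrite horner0; exact: linear0_cst.
under eq_fun do rewrite hornerMXaddC; rewrite hornerMXaddC.
exact: linear0D (linear0M IH h) (linear0_cst _).
Qed.

Lemma strip_scale (a : R) t : 0 < a -> a <= 2 -> strip 0 t ->
  [/\ - (a%:C * t) != 0, `|complex.Re (- (a%:C * t))| <= 2 * M &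
     `|complex.Im (- (a%:C * t))| <= pi].
Proof.
move=> a0 a2 [t0 tM]; rewrite subr0 => tpi.
have aC : a%:C != 0 by apply/eqP => -[] /eqP; rewrite gt_eqF.
split; first by rewrite oppr_eq0 mulf_neq0.
all: clear t0; case: t tM tpi => x y /= tM tpi.
- rewrite mul0r subr0 normrN normrM (gtr0_norm a0) ler_pM// ltW//.
- rewrite mul0r addr0 normrN normrM (gtr0_norm a0).
  have -> : (pi : R) = 2 * (pi / 2) by field.
  by rewrite ler_pM// ltW.
Qed.

Lemma linear0_Cexp (a : R) : 0 < a -> a <= 2 ->
  linear0 (fun t => Cexp (- (a%:C * t))) 1.
Proof.
move=> a0 a2; have [K K0 HK] := Cexp_taylor (2 * M).
pose L := `|M| + (pi : R).
have L0 : 0 <= L by rewrite addr_ge0 ?pi_ge0.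
exists (4 * K * L + 2); first by rewrite addr_ge0 ?mulr_ge0.
move=> t ht; have [u0 uM upi] := strip_scale a0 a2 ht.
move: {HK}(HK _ uM upi); set u := - (a%:C * t) => HK.
have nu : nm u <= 2 * nm t.
  by rewrite /u nmN nmM nm_real gtr0_norm// ler_wpM2r ?nm_ge0.
have -> : Cexp u - 1 = (Cexp u - 1 - u) + u by ring.
apply: le_trans (nmD _ _) _.
have h : K * nm u ^+ 2 <= K * (4 * L * nm t).
  rewrite ler_wpM2l//; apply: (@le_trans _ _ ((2 * nm t) ^+ 2)).
    by rewrite ler_pXn2r ?nnegrE ?mulr_ge0 ?nm_ge0.
  have := strip_bound ht; rewrite -/L => hL.
  have : nm t * nm t <= L * nm t by rewrite ler_wpM2r ?nm_ge0.
  by rewrite exprMn expr2 (expr2 (nm t)); lra.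
by move: HK h nu; rewrite !mulrDl; lra.
Qed.

(** Here the lower bound [Cexp_sub1_ge] on the denominator is essential. *)
Lemma linear0_ratio :
  linear0 (fun t => 2 * t / (1 - Cexp (- t) ^+ 2)) 1.
Proof.
have [K K0 HK] := Cexp_taylor (2 * M).
pose c := expR (- (2 * M)) / 2; have c0 : 0 < c by rewrite divr_gt0// expR_gt0.
exists (K * 4 / (2 * c)); first by rewrite divr_ge0 ?mulr_ge0// ltW.
move=> t ht; have [u0 uM upi] := strip_scale (ltr0Sn R 1) (lexx 2) ht.
have := Cexp_sub1_ge uM upi; rewrite -/c.
move: {HK}(HK _ uM upi).
have uE : - (2%:C * t) = 2%:R * (- t) by rewrite rmorph_nat mulrN.
have EE : Cexp (- (2%:C * t)) = Cexp (- t) ^+ 2 by rewrite uE CexpMn.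
have nu : nm (- (2%:C * t)) = 2 * nm t by rewrite nmN nmM nm_real ger0_norm.
rewrite EE nu; set X := Cexp (- t) ^+ 2 => h1 h2.
have t0 : 0 < nm t by rewrite nm_gt0; case: ht.
have X1 : 0 < nm (X - 1).
  exact: lt_le_trans (mulr_gt0 c0 (mulr_gt0 (ltr0Sn _ 1) t0)) h2.
have X0 : 1 - X != 0 by rewrite -nm_gt0 nmBC.
have -> : 2 * t / (1 - X) - 1 = (X - 1 - 2%:R * (- t)) / (1 - X) by field.
rewrite -uE nmM nmV (nmBC 1 X) ler_pdivrMr//.
apply: le_trans h1 _.
have : K * 4 / (2 * c) * nm t * (c * (2 * nm t)) <= K * 4 / (2 * c) * nm t * nm (X - 1).
  by apply: ler_wpM2l h2; rewrite mulr_ge0 ?nm_ge0// divr_ge0 ?mulr_ge0// ltW.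
apply: le_trans; rewrite le_eqVlt; apply/orP; left; apply/eqP.
by field; rewrite gt_eqF.
Qed.

(** The factor t^(m+1) is absorbed by the ratios 2t / (1 - exp(-2t)), and the
    normalization comes from the value 2^m m! of the Eulerian polynomial at
    1. *)
Lemma linear0_oddexp m : linear0 (fun t => t ^+ m.+1 * oddexp m t) 1.
Proof.
have h1 : linear0 (fun t => Cexp (- t)) 1.
  by have := linear0_Cexp ltr01 (ler1n _ 2); under eq_fun do rewrite rmorph1 mul1r.
have h2 := linear0_horner (eulerianB C m) (linear0X 2 h1).
have h3 := linear0X m.+1 linear0_ratio.
have := linear0M (linear0M (linear0_cst (2 / m`!%:R / 2 ^+ m.+1)) h1) (linear0M h2 h3).
rewrite !expr1n eulerianB_at1 !mulr1.
have f0 : (m`!%:R : C) != 0 by rewrite pnatr_eq0 -lt0n fact_gt0.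
rewrite (_ : _ * (_ * _) = 1); last by rewrite exprS; field; rewrite f0 expf_neq0.
case=> Q Q0 HQ; exists Q => // t ht; rewrite (le_trans _ (HQ t ht))//.
rewrite le_eqVlt; apply/orP; left; apply/eqP; congr (nm (_ - 1)).
rewrite /oddexp /oddgf !expr_div_n exprMn.
have t2 : (2 : C) ^+ m.+1 != 0 by rewrite expf_neq0.
set D := (1 - _ ^+ 2) ^+ m.+1; set B := _.[_].
have -> : t ^+ m.+1 * (2 / m`!%:R * (Cexp (- t) * B / D)) =
  2 / m`!%:R * Cexp (- t) * B * t ^+ m.+1 * D^-1 by ring.
move: t2; set P := 2 ^+ m.+1 => t2.
transitivity ((P^-1 * P) * (2 / m`!%:R * Cexp (- t) * B * t ^+ m.+1 / D)).
  by rewrite mulVf// mul1r.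
by ring.
Qed.

(** What is left of [oddexp] without its pole at 0; it is dominated by the
    two poles next to 0, whose sizes are added up in [poles]. *)
Definition remainder m t := oddexp m t - t ^- m.+1.
Definition poles m t : R := nm (t + i_pi) ^- m.+1 + nm (t - i_pi) ^- m.+1.

(** A crude bound with an uncontrolled dependence on m, needed only to start
    the iteration.  Since the pole has order m + 1, removing its leading term
    leaves a singularity of order at most m: this gain of one order is what
    the contraction uses near 0. *)
Lemma remainder_apriori m : exists2 Q, 0 <= Q &
  forall t, strip 0 t -> nm (remainder m t) <= Q * Num.max 1 (nm t ^- m).
Proof.
have [Q Q0 HQ] := linear0_oddexp m; exists Q => // t ht.
have t0 : t != 0 by case: ht.
have n0 : 0 < nm t by rewrite nm_gt0.
have -> : remainder m t = (t ^+ m.+1 * oddexp m t - 1) / t ^+ m.+1.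
  by rewrite /remainder; field; rewrite expf_neq0.
rewrite nmM nmV nmX ler_pdivrMr ?exprn_gt0//.
apply: le_trans (HQ t ht) _; rewrite -mulrA ler_wpM2l//.
have E : nm t ^- m * nm t ^+ m.+1 = nm t.
  by rewrite exprS mulrCA mulVf ?mulr1// expf_neq0// gt_eqF.
by rewrite -{1}E ler_wpM2r ?exprn_ge0 ?nm_ge0// le_max lexx orbT.
Qed.

(** The imaginary parts satisfy (pi/2 + pi) / 3 = pi/2: the strip is mapped to
    itself, with equality on the boundary. *)
Lemma strip_triple t : strip 0 t ->
  [/\ strip 0 (t / 3), strip 0 ((t + i_pi) / 3) & strip 0 ((t - i_pi) / 3)].
Proof.
case=> t0 tM; rewrite subr0 => tpi.
have p := pi_gt0 R.
have E3 : (3^-1 : C) = (3^-1)%:C by rewrite fmorphV rmorph_nat.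
have n3 : (3^-1 : C) != 0 by rewrite invr_eq0 pnatr_eq0.
have S (c : C) (y : R) : c = t + 0 +i* (y - complex.Im t) ->
    `|y| <= 3 * pi / 2 -> c != 0 -> strip 0 (c / 3).
  move=> -> hy h0; split; first by rewrite mulf_neq0.
    rewrite E3; case: (t) tM => a b /=.
    rewrite !(mulr0, addr0, subr0) normrM => aM.
    rewrite (le_trans _ aM)//; rewrite -[leRHS]mulr1 ler_wpM2l//.
    by rewrite ger0_norm; lra.
  rewrite E3 subr0; case: (t) => a b /=.
  rewrite !(mulr0, add0r) addrC subrK normrM (ger0_norm (_ : 0 <= 3^-1)) ?invr_ge0//.
  lra.
have ht : - (pi / 2) <= complex.Im t <= pi / 2 by rewrite -ler_norml.
split.
- apply: (S _ (complex.Im t)) => //.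
    by rewrite subrr; case: (t) => a b; apply/eqP; rewrite eq_complex /= !addr0 !eqxx.
  by rewrite (le_trans tpi)//; lra.
- apply: (S _ (complex.Im t + pi)).
  + rewrite /i_pi; case: (t) => a b; apply/eqP; rewrite eq_complex /=.
    by apply/andP; split=> //; apply/eqP; ring.
  + by rewrite ler_norml; apply/andP; split; lra.
  + rewrite /i_pi; case: (t) ht => a b /= hb; rewrite eq_complex /= negb_and.
    by apply/orP; right; rewrite gt_eqF//; lra.
- apply: (S _ (complex.Im t - pi)).
  + rewrite /i_pi; case: (t) => a b; apply/eqP; rewrite eq_complex /=.
    by apply/andP; split=> //; apply/eqP; ring.
  + by rewrite ler_norml; apply/andP; split; lra.
  + rewrite /i_pi; case: (t) ht => a b /= hb; rewrite eq_complex /= negb_and.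
    by apply/orP; right; rewrite lt_eqF//; lra.
Qed.

Lemma remainder_le m t : strip 0 t ->
  nm (remainder m t) <= 3 ^- m.+1 * (nm (remainder m (t / 3)) + nm (remainder m ((t + i_pi) / 3)) +
     nm (remainder m ((t - i_pi) / 3))) + poles m t.
Proof.
move=> ht; have [_ h2 h3] := strip_triple ht.
have [t0 _ tpi] := ht; rewrite subr0 in tpi.
have n3 : (3 : C) != 0 by rewrite pnatr_eq0.
have a0 : t + i_pi != 0 by case: h2 => /eqP h _ _; apply/eqP => E; apply: h; rewrite E mul0r.
have b0 : t - i_pi != 0 by case: h3 => /eqP h _ _; apply/eqP => E; apply: h; rewrite E mul0r.
have -> : remainder m t = 3 ^- m.+1 *
     (remainder m (t / 3) - remainder m ((t + i_pi) / 3) - remainder m ((t - i_pi) / 3))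
   - (t + i_pi) ^- m.+1 - (t - i_pi) ^- m.+1.
  by rewrite /remainder (oddexp_triple m t0 tpi) (subr_poles_triple _ _ _ _ _ (t + i_pi) (t - i_pi)).
apply: le_trans (nmD _ _) _; rewrite nmN.
rewrite /poles addrA -!nmX -!nmV lerD2r.
apply: le_trans (nmD _ _) _; rewrite nmN lerD2r.
rewrite nmM nmV nmX nm_nat.
rewrite ler_wpM2l ?invr_ge0 ?exprn_ge0//.
apply: le_trans (nmD _ _) _; rewrite nmN lerD2r.
by apply: le_trans (nmD _ _) _; rewrite nmN.
Qed.

End ExponentialVariable.

(** * Asymptotics as m tends to infinity *)
Section Estimate.
Variable R : realType.
Local Notation C := (R[i]).
Local Notation nm := (@Normc.normc R).

(** A value of pi strictly above 2 is needed for the contraction; this one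
    comes from 1 - cos x <= x^2 / 2 at x = pi/2. *)
Lemma pi_sqr_ge8 : 8 <= (pi : R) ^+ 2.
Proof.
have := onem_cos_le (pi / 2 : R); rewrite cos_pihalf subr0 expr_div_n.
by lra.
Qed.

Lemma expr_small (r e : R) : 0 <= r -> r < 1 -> 0 < e ->
  exists N, forall n, (N <= n)%N -> r ^+ n <= e.
Proof.
move=> r0 r1 e0.
have cv : (1 : R) * r ^+ k @[k --> \oo] --> (0 : R).
  by apply: cvg_geometric; rewrite ger0_norm.
have /cvgr0Pnorm_le/(_ e e0) := cv.
case=> N _ HN; exists N => n Nn; have := HN n Nn.
by rewrite mul1r ger0_norm ?exprn_ge0.
Qed.

(** Comparing |z| with |z'| for points with the same real part: a gap g
    between the squared imaginary parts gives a ratio bounded away from 1,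
    uniformly on bounded sets. *)
Lemma nm_shrink (M L g : R) : 0 < g -> exists r : R, [/\ 0 <= r, r < 1 &
  forall z z' : C, complex.Re z = complex.Re z' -> `|complex.Re z| <= M ->
    complex.Im z ^+ 2 + g <= complex.Im z' ^+ 2 -> `|complex.Im z'| <= L ->
    nm z <= r * nm z'].
Proof.
move=> g0; pose B := M ^+ 2 + L ^+ 2 + g + 1.
have B0 : 0 < B by rewrite /B; have := sqr_ge0 M; have := sqr_ge0 L; lra.
have gB : g / B < 1.
  by rewrite ltr_pdivrMr// mul1r /B; have := sqr_ge0 M; have := sqr_ge0 L; lra.
have gB0 : 0 < g / B by rewrite divr_gt0.
exists (1 - g / B / 2); split; [lra|lra|].
move=> [x y] [x' y'] /= <- {x'} xM yg yL.
have r0 : 0 <= 1 - g / B / 2 by lra.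
have x2 : x ^+ 2 <= M ^+ 2.
  by rewrite -(real_normK (num_real x)) ler_pXn2r ?nnegrE// (le_trans _ xM).
have y2 : y' ^+ 2 <= L ^+ 2.
  by rewrite -(real_normK (num_real y')) ler_pXn2r ?nnegrE// (le_trans _ yL).
rewrite -[leLHS]/(nm (x +i* y)) -[X in _ <= _ * X]/(nm (x +i* y')).
rewrite -(ler_pXn2r (_ : 0 < 2)%N) ?nnegrE ?mulr_ge0 ?nm_ge0//.
rewrite exprMn !nm_sqr /=.
have h : g / B * (x ^+ 2 + y' ^+ 2) <= g.
  rewrite mulrAC ler_pdivrMr// ler_wpM2l ?ltW//.
  by rewrite /B; lra.
have := sqr_ge0 x; have := sqr_ge0 y'.
move: h yg gB gB0 {x2 y2 xM yL}; set e := g / B; set X := x ^+ 2; set Y := y' ^+ 2.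
move=> h yg e1 e0 Y0 X0.
have : (1 - e) * (X + Y) <= (1 - e / 2) ^+ 2 * (X + Y).
  by rewrite ler_wpM2r ?addr_ge0//; have := sqr_ge0 e; nra.
lra.
Qed.

Section Fixed.
Variable M : R.
Local Notation strip := (strip M).

Lemma Im_add_i_pi (t : C) (j : R) :
  complex.Im (t + j%:C * i_pi R) = complex.Im t + j * pi /\
  complex.Re (t + j%:C * i_pi R) = complex.Re t.
Proof. by case: t => a b /=; split; ring. Qed.

(** The six terms are the poles at 2 i pi, 3 i pi, 4 i pi and their opposites,
    seen from t.  They are farther than the two poles at i pi and - i pi, by
    a factor that is uniform on the rectangle. *)
Lemma poles_shrink : exists r : R, [/\ 0 <= r, r < 1 &
  forall m t, strip 0 t ->
    3 ^- m * (nm (t / 3 + i_pi R) ^- m + nm (t / 3 - i_pi R) ^- m) <=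
    r ^+ m * (nm (t + i_pi R) ^- m + nm (t - i_pi R) ^- m) /\ 
    3 ^- m * (nm ((t + i_pi R) / 3 + i_pi R) ^- m + nm ((t + i_pi R) / 3 - i_pi R) ^- m) <=
    r ^+ m * (nm (t + i_pi R) ^- m + nm (t - i_pi R) ^- m) /\
    3 ^- m * (nm ((t - i_pi R) / 3 + i_pi R) ^- m + nm ((t - i_pi R) / 3 - i_pi R) ^- m) <=
    r ^+ m * (nm (t + i_pi R) ^- m + nm (t - i_pi R) ^- m)].
Proof.
have p := pi_gt0 R; have p2 : 0 < 2 * (pi : R) ^+ 2 by rewrite mulr_gt0// exprn_gt0.
have [r [r0 r1 Hr]] := nm_shrink M (9 * pi / 2) p2.
exists r; split=> // m.
(* (y + j pi)^2 - (y + pi)^2 >= 2 pi^2 if y >= - pi/2 and j >= 2 *)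
have key (t : C) (j : R) : `|complex.Re t| <= M -> `|complex.Im t| <= pi / 2 ->
    2 <= j -> j <= 4 -> nm (t + i_pi R) <= r * nm (t + j%:C * i_pi R).
  move=> tM ht j2 j4.
  have [I1 R1] := Im_add_i_pi t j; have [I2 R2] := Im_add_i_pi t 1.
  rewrite rmorph1 !mul1r in I2 R2.
  move: ht; rewrite ler_norml => /andP[h1 h2].
  apply: Hr; rewrite ?R2 ?R1// ?I1 ?I2.
    have : 0 <= (j - 2) * (j + 2 - 1) * (pi ^+ 2) by apply: mulr_ge0 (sqr_ge0 _); apply: mulr_ge0; lra.
    have : 0 <= (j - 1) * pi * (complex.Im t + pi / 2) by apply: mulr_ge0; [apply: mulr_ge0|]; lra.
    nra.
  have ? : 0 <= (j - 2) * pi by apply: mulr_ge0; lra.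
  have ? : 0 <= (4 - j) * pi by apply: mulr_ge0; lra.
  by rewrite ger0_norm; lra.
have key2 (t u : C) (j : R) : strip 0 t -> 2 <= j -> j <= 4 -> 3 * u = t + j%:C * i_pi R ->
    3 ^- m * nm u ^- m <= r ^+ m * nm (t + i_pi R) ^- m.
  rewrite /strip subr0 => -[t0 tM ht] j2 j4 E.
  have := key _ _ tM ht j2 j4; rewrite -E nmM nm_nat.
  have a0 : 0 < nm (t + i_pi R).
    have [I2 R2] := Im_add_i_pi t 1; rewrite rmorph1 !mul1r in I2 R2.
    rewrite nm_gt0; apply/eqP => E0; move: I2; rewrite E0 /=.
    by move: ht; rewrite ler_norml => /andP[]; lra.
  move=> h; have u0 : 0 < nm u.
    rewrite lt_def nm_ge0 andbT; apply/eqP => u0.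
    by move: h; rewrite u0 !mulr0 leNgt a0.
  rewrite -!exprVn -!exprMn; apply: lerXn2r; rewrite ?nnegrE ?mulr_ge0 ?invr_ge0 ?nm_ge0//.
  by rewrite -invfM ler_pdivlMr// ler_pdivrMl ?mulr_gt0// mulrC.
have stripN (x : C) : strip 0 x -> strip 0 (- x).
  case=> x0 xM hx; split; rewrite ?oppr_eq0//.
    by case: (x) xM => a b; rewrite /= normrN.
  by case: (x) hx => a b; rewrite /= normrN.
move=> t ht; have htN := stripN _ ht.
have nN : nm (- t + i_pi R) = nm (t - i_pi R) by rewrite -[LHS]nmN opprD opprK.
have n3 : (3 : C) != 0 by rewrite pnatr_eq0.
have K1 u j := @key2 t u j ht; have K2 u j := @key2 (- t) u j htN.
rewrite nN in K2.
have KK (u v : C) (i j : R) : 2 <= i -> i <= 4 -> 2 <= j -> j <= 4 ->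
  3 * u = t + i%:C * i_pi R -> - (3 * v) = - t + j%:C * i_pi R ->
   3 ^- m * (nm u ^- m + nm v ^- m) <=
    r ^+ m * (nm (t + i_pi R) ^- m + nm (t - i_pi R) ^- m).
  move=> i2 i4 j2 j4 hu hv; rewrite !mulrDr lerD// ?(K1 u i)//.
  by rewrite -(nmN v); apply: (K2 _ j) => //; rewrite mulrN.
have l2 : (2 : R) <= 2 by []. have l3 : (2 : R) <= 3 by lra.
have l4 : (2 : R) <= 4 by lra. have g3 : (3 : R) <= 4 by lra.
split; [|split].
- by apply: (KK _ _ 3 3) => //; rewrite rmorph_nat; field.
- by apply: (KK _ _ 4 2) => //; rewrite rmorph_nat; field.
- by apply: (KK _ _ 2 4) => //; rewrite rmorph_nat; field.
Qed.

End Fixed.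
End Estimate.

Section Asymptotics.
Variable R : realType.
Local Notation C := (R[i]).
Local Notation nm := (@Normc.normc R).

(** The weight of the contraction: it allows the singularity of order m at the
    origin left by [remainder_apriori] and is constant elsewhere. *)
Let weight (m : nat) (t : C) : R := Num.max 1 (nm t ^- m).

Let weight_ge1 m t : 1 <= weight m t. Proof. by rewrite le_max lexx. Qed.

Lemma nm_third (t : C) : nm (t / 3) = nm t / 3.
Proof. by rewrite nmM nmV nm_nat. Qed.

(** The term at t/3 contributes 1/3.  The other two points are at distance at
    least pi/6 >= 2/5 from 0, hence contribute at most (5/6)^m / 3 <= 5/18
    each, and 1/3 + 2 * 5/18 = 8/9. *)
Let weight_contract M m t : (0 < m)%N -> strip M 0 t ->
  3 ^- m.+1 * (weight m (t / 3) + weight m ((t + i_pi R) / 3) +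
    weight m ((t - i_pi R) / 3)) <= 8 / 9 * weight m t.
Proof.
move=> m0 [t0 _]; rewrite subr0 ler_norml => /andP[h1 h2].
have p := pi_gt0 R.
have w1 := weight_ge1 m t.
have p65 : 6 / 5 <= pi / 2 :> R.
  have := pi_sqr_ge8 R; rewrite leNgt => h; rewrite leNgt; apply/negP => h'.
  move/negP: h; apply; have : (pi : R) < 12 / 5 by lra.
  by move=> ?; rewrite expr2; nra.
have wt : weight m (t / 3) <= 3 ^+ m * weight m t.
  rewrite ge_max; apply/andP; split.
    by rewrite -[leLHS]mulr1 ler_pM// exprn_ege1// ler1n.
  by rewrite nm_third expr_div_n invf_div ler_wpM2l ?exprn_ge0// le_max lexx orbT.
have wa (a : C) : 6 / 5 <= nm a -> weight m (a / 3) <= (5 / 2) ^+ m.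
  move=> ha; rewrite ge_max; apply/andP; split; first by rewrite exprn_ege1//; lra.
  rewrite nm_third -exprVn lerXn2r ?nnegrE ?invr_ge0 ?divr_ge0 ?nm_ge0//.
  by rewrite invf_div ler_pdivrMr; lra.
have ha : 6 / 5 <= nm (t + i_pi R).
  apply: le_trans (nm_Im _); apply: le_trans (ler_norm _).
  by case: (t) h1 h2 => a b /= h1 h2; lra.
have hb : 6 / 5 <= nm (t - i_pi R).
  rewrite -nmN; apply: le_trans (nm_Im _); apply: le_trans (ler_norm _).
  by case: (t) h1 h2 => a b /= h1 h2; lra.
have := wa _ ha; have := wa _ hb; move: wt.
set x := weight m (t / 3); set w := weight m t.
set y := weight m _; set z := weight m _.
move=> hx hz hy.
have t3 : 0 < 3 ^+ m.+1 :> R by rewrite exprn_gt0.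
rewrite ler_pdivrMl//.
have P56 : (5 / 2) ^+ m <= 5 / 6 * 3 ^+ m :> R.
  case: (m) m0 => // k _.
  have : (5 / 2) ^+ k <= 3 ^+ k :> R by rewrite lerXn2r ?nnegrE; lra.
  by rewrite !exprS; lra.
have P0 : 0 <= 3 ^+ m :> R by rewrite exprn_ge0.
have : 3 ^+ m <= 3 ^+ m * w by rewrite -[leLHS]mulr1 ler_wpM2l.
rewrite exprS; lra.
Qed.

(** Once m is so large that [poles_shrink] gives a factor at most 1/6, the
    three groups of poles produced by one step amount to at most half of
    [poles], so the bound 2 * [poles] is stable: 2 * (1/2) + 1 = 2.  The rest
    of the bound contracts to 0. *)
Lemma remainder_le_poles M : exists m0, forall m, (m0 <= m)%N -> forall t, strip M 0 t ->
  nm (remainder m t) <= 2 * poles m t.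
Proof.
have [r [r0 r1 Hr]] := poles_shrink M.
have i6 : 0 < 6^-1 :> R by rewrite invr_gt0.
have [N HN] := expr_small r0 r1 i6.
exists N.+1 => m Nm.
have m0 : (0 < m)%N by case: m Nm.
have rm : r ^+ m.+1 <= 6^-1 by apply: HN; rewrite leqW// ltnW.
have [Q Q0 HQ] := remainder_apriori M m.
have p0 t : 0 <= poles m t by rewrite addr_ge0// invr_ge0 exprn_ge0 ?nm_ge0.
have H k t : strip M 0 t ->
    nm (remainder m t) <= (8 / 9) ^+ k * (Q * weight m t) + 2 * poles m t.
  elim: k t => [|k IH] t ht.
    by rewrite expr0 mul1r; apply: le_trans (HQ t ht) _; rewrite lerDl mulr_ge0 ?p0.
  have [h1 h2 h3] := strip_triple ht.
  apply: le_trans (remainder_le m ht) _.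
  have [g1 [g2 g3]] := Hr m.+1 t ht.
  have := lerD (lerD (IH _ h1) (IH _ h2)) (IH _ h3).
  have T0 : 0 <= 3 ^- m.+1 :> R by rewrite invr_ge0 exprn_ge0.
  move=> /(ler_wpM2l T0).
  have := weight_contract m0 ht.
  have K0 : 0 <= (8 / 9) ^+ k * Q by rewrite mulr_ge0// exprn_ge0// divr_ge0.
  move=> /(ler_wpM2l K0).
  have g4 : r ^+ m.+1 * poles m t <= 6^-1 * poles m t by rewrite ler_wpM2r ?p0.
  move: g1 g2 g3; rewrite -/(poles m (t / 3)) -/(poles m ((t + i_pi R) / 3)).
  rewrite -/(poles m ((t - i_pi R) / 3)) -/(poles m t).
  rewrite (exprS (8 / 9) k); set T := 3 ^- m.+1; set K := (8 / 9) ^+ k; clearbody T K.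
  move: (r ^+ m.+1 * poles m t) g4 => rp.
  lra.
move=> t ht; rewrite leNgt; apply/negP; rewrite -subr_gt0 => d0.
have B0 : 0 < Q * weight m t + 1.
  by rewrite ltr_wpDl// mulr_ge0// (le_trans _ (weight_ge1 m t)).
have [|||k Hk] := @expr_small R (8 / 9) ((nm (remainder m t) - 2 * poles m t) / (Q * weight m t + 1)).
- by rewrite divr_ge0.
- by lra.
- by rewrite divr_gt0.
have := Hk k (leqnn k); rewrite ler_pdivlMr// (mulrDr _ _ 1) mulr1; have := H k t ht.
have : 0 < (8 / 9) ^+ k :> R by rewrite exprn_gt0// divr_gt0.
by lra.
Qed.

(** The distance to the lines Im t = pi/2 and Im t = - pi/2 makes |t| smaller
    than |t + i pi| and |t - i pi| by a uniform factor. *)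
Lemma oddexp_asymp M d e : 0 < d -> 0 < e -> exists m0, forall m, (m0 <= m)%N ->
  forall t, strip M d t -> nm (t ^+ m.+1 * oddexp m t - 1) <= e.
Proof.
move=> d0 e0; have p := pi_gt0 R.
have g0 : 0 < 2 * pi * d by rewrite !mulr_gt0.
have [r [r0 r1 Hr]] := nm_shrink M (3 * pi / 2) g0.
have e4 : 0 < e / 4 by rewrite divr_gt0.
have [N HN] := expr_small r0 r1 e4.
have [N' HN'] := remainder_le_poles M.
exists (maxn N N') => m; rewrite geq_max => /andP[Nm N'm] t [t0 tM].
rewrite ler_norml => /andP[h1 h2].
have ht : strip M 0 t by split=> //; rewrite subr0 ler_norml; apply/andP; split; lra.
have -> : t ^+ m.+1 * oddexp m t - 1 = t ^+ m.+1 * remainder m t.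
  by rewrite /remainder mulrBr mulfV// expf_neq0.
rewrite nmM nmX; have := HN' m N'm t ht.
move=> /(ler_wpM2l (exprn_ge0 m.+1 (nm_ge0 t))) /le_trans; apply.
have rm : r ^+ m.+1 <= e / 4 by apply: HN; rewrite leqW.
have k1 : nm t <= r * nm (t + i_pi R).
  apply: Hr => //; case: (t) h1 h2 => a b /= h1 h2; rewrite ?addr0//.
    have ? : 0 <= pi * (b + (pi / 2 - d)) by apply: mulr_ge0; lra.
    nra.
  by rewrite ger0_norm; lra.
have k2 : nm t <= r * nm (t - i_pi R).
  apply: Hr => //; case: (t) h1 h2 => a b /= h1 h2; rewrite ?subr0//.
    have ? : 0 <= pi * ((pi / 2 - d) - b) by apply: mulr_ge0; lra.
    nra.
  by rewrite ler0_norm; lra.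
have n0 : 0 < nm t by rewrite nm_gt0.
have key a : nm t <= r * nm a -> nm t ^+ m.+1 * nm a ^- m.+1 <= e / 4.
  move=> h; have a0 : 0 < nm a.
    rewrite lt_def nm_ge0 andbT; apply/eqP => a0.
    by move: h; rewrite a0 mulr0 leNgt n0.
  apply: le_trans rm; rewrite ler_pdivrMr ?exprn_gt0// -exprMn.
  by apply: lerXn2r; rewrite ?nnegrE ?mulr_ge0 ?nm_ge0.
have := key _ k1; have := key _ k2; rewrite mulrCA mulrDr; lra.
Qed.

Lemma oddgf_ratio M d e : 0 < d -> 0 < e -> exists m0, forall m, (m0 <= m)%N ->
  forall t, strip M d t -> oddgf m (Cexp (- t)) != 0 /\
    nm (t / m.+1%:R * (oddgf m.+1 (Cexp (- t)) / oddgf m (Cexp (- t))) - 1) <= e.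
Proof.
move=> d0 e0.
(* if F and G are within e' <= 1/2 of 1 then |G/F - 1| <= 4 e' *)
pose e' := Num.min (1 / 2) (e / 4).
have e'0 : 0 < e' by rewrite lt_min !divr_gt0.
have [e1 e2] : e' <= 1 / 2 /\ e' <= e / 4 by rewrite !ge_min !lexx orbT.
have [N HN] := oddexp_asymp M d0 e'0.
exists N => m Nm t ht.
have f0 : (m`!%:R : C) != 0 by rewrite pnatr_eq0 -lt0n fact_gt0.
have f1 : (m.+1%:R : C) != 0 by rewrite pnatr_eq0.
have t0 : t != 0 by case: ht.
have := HN m.+1 (leqW Nm) t ht; have := HN m Nm t ht.
set F := t ^+ m.+1 * _; set G := t ^+ m.+2 * _ => HF HG.
have F0 : 2^-1 <= nm F.
  have := nmB_ge 1 (1 - F); rewrite (_ : 1 - (1 - F) = F); last by ring.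
  by rewrite nm1 nmBC; lra.
have F1 : F != 0 by rewrite -nm_gt0; lra.
have A0 : oddgf m (Cexp (- t)) != 0.
  by apply: contraNneq F1; rewrite /F /oddexp => ->; rewrite !mulr0.
split=> //.
have -> : t / m.+1%:R * (oddgf m.+1 (Cexp (- t)) / oddgf m (Cexp (- t))) = G / F.
  rewrite /F /G /oddexp factS natrM (exprS t m.+1).
  have tm : t ^+ m.+1 != 0 by rewrite expf_neq0.
  move: (t ^+ m.+1) tm => T T0.
  by field; rewrite f0 A0 T0 nat1r f1.
have -> : G / F - 1 = ((G - 1) - (F - 1)) / F by field.
rewrite nmM nmV ler_pdivrMr; last by lra.
apply: le_trans (nmD _ _) _; rewrite nmN.
have : e * 2^-1 <= e * nm F by rewrite ler_wpM2l// ltW.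
lra.
Qed.

End Asymptotics.

(** * From z to t, and the limit *)
Section Limit.
Variable R : realType.
Local Notation C := (Cplx R).
Local Notation nm := (@Normc.normc R).

Lemma Re_sqrtc_ge0 (z : R[i]) : 0 <= complex.Re (sqrtc z).
Proof. case: z => a b; by rewrite sqrtr_ge0. Qed.

(** The principal logarithm is a right inverse of the exponential; both are
    given by real functions. *)
Lemma CexpK (u : R[i]) : u != 0 -> Cexp (Clog u) = u.
Proof.
move=> u0; have n0 : 0 < nm u by rewrite nm_gt0.
have bnd : -1 <= complex.Re u / nm u <= 1.
  by rewrite -ler_norml normrM normfV (ger0_norm (nm_ge0 u)) ler_pdivrMr// mul1r nm_Re.
have c : cos (Carg u) = complex.Re u / nm u.
  by rewrite /Carg; case: ifP => _; rewrite ?cosN acosK// in_itv.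
have s : sin (Carg u) = complex.Im u / nm u.
  have E : Num.sqrt (1 - (complex.Re u / nm u) ^+ 2) = `|complex.Im u| / nm u.
    have -> : 1 - (complex.Re u / nm u) ^+ 2 = (complex.Im u / nm u) ^+ 2.
      rewrite !expr_div_n; apply: (mulIf (lt0r_neq0 (exprn_gt0 2 n0))).
      rewrite mulrBl mul1r !divfK ?expf_neq0 ?gt_eqF//.
      by rewrite nm_sqr; ring.
    by rewrite sqrtr_sqr normrM normfV (ger0_norm (nm_ge0 u)).
  rewrite /Carg; case: ifP => iu; rewrite ?sinN sin_acos// E.
    by rewrite ger0_norm.
  by rewrite ltr0_norm ?mulNr ?opprK// ltNge iu.
rewrite /Cexp /Clog /= lnK ?posrE// c s ![nm u * _]mulrC !divfK ?gt_eqF//.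
by case: (u).
Qed.

(** The hypothesis excludes the negative real axis, on which both u and 1/u
    have argument pi. *)
Lemma ClogV (u : R[i]) : u != 0 -> (complex.Im u = 0 -> 0 < complex.Re u) ->
  Clog u^-1 = - Clog u.
Proof.
move=> u0 upos; have n0 : 0 < nm u by rewrite nm_gt0.
rewrite /Clog nmV lnV ?posrE//.
have rE : complex.Re u^-1 / (nm u)^-1 = complex.Re u / nm u.
  have -> : complex.Re u^-1 = complex.Re u / nm u ^+ 2 by rewrite nm_sqr; case: (u).
  by field; rewrite gt_eqF.
suff -> : Carg u^-1 = - Carg u by [].
rewrite /Carg nmV rE.
have iE : complex.Im u^-1 = - complex.Im u / nm u ^+ 2.
  by rewrite nm_sqr mulNr; case: (u).
have n2 : 0 < (nm u ^+ 2)^-1 by rewrite invr_gt0 exprn_gt0.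
rewrite iE pmulr_lge0// oppr_ge0.
case: (ltgtP (complex.Im u) 0) => // i0; rewrite ?opprK//.
have -> : complex.Re u / nm u = 1; last by rewrite acos1 oppr0.
have -> : nm u = complex.Re u; last by rewrite mulfV// gt_eqF// upos.
have := upos i0; case: (u) i0 => a b /= -> a0.
by rewrite expr0n /= addr0 sqrtr_sqr gtr0_norm.
Qed.

(** The segment [0, 1] is the equality case of the triangle inequality
    |z| + |1 - z| >= 1. *)
Lemma segment_triangle (z : C) : ~ segment01 z -> 1 < nm z + nm (z - 1).
Proof.
move=> zs; rewrite ltNge; apply/negP => h; apply: zs.
have h1 := nm_Re z; have h2 := nm_Re (z - 1).
have [a [b zE]] : exists a b, z = a +i* b by case: (z) => a b; exists a, b.
have r1 : complex.Re z = a by rewrite zE.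
have r2 : complex.Re (z - 1) = a - 1 by rewrite zE.
have s1 := nm_sqr z; have s2 := nm_sqr (z - 1).
have i1 : complex.Im z = b by rewrite zE.
have i2 : complex.Im (z - 1) = b by rewrite zE /= subr0.
rewrite r1 i1 in s1 h1; rewrite r2 i2 in s2 h2.
move: h1 h2; rewrite !ler_norml => /andP[h1 h2] /andP[h3 h4].
have a0 : 0 <= a by lra.
have a1 : a <= 1 by lra.
have b0 : b = 0.
  have e1 : nm z = a by lra.
  apply/eqP; rewrite -sqrf_eq0; apply/eqP.
  by rewrite e1 in s1; lra.
by exists a; [rewrite /= in_itv /= a0 a1|rewrite zE b0].
Qed.

(** For small e this is a neighbourhood of a given point outside the segment,
    described by |z| and |z - 1| only, without any choice of a square
    root. *)
Definition away (e : R) (z : C) :=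
  [/\ e <= nm z, e <= nm (z - 1), nm z <= e^-1 & 1 + e <= nm z + nm (z - 1)].

Lemma nbhs_away (z : C) : ~ segment01 z ->
  exists e : R, [/\ 0 < e, e <= 1 & nbhs z (away e)].
Proof.
move=> zs; have h := segment_triangle zs.
have z0 : 0 < nm z.
  rewrite nm_gt0; apply/eqP => z0; apply: zs; exists 0 => //.
  by rewrite /= in_itv /= lexx ler01.
have z1 : 0 < nm (z - 1).
  rewrite nm_gt0 subr_eq0; apply/eqP => z1; apply: zs; exists 1 => //.
  by rewrite /= in_itv /= lexx ler01.
pose e := Num.min (Num.min 1 (nm z / 2)) (Num.min (nm (z - 1) / 2)
  (Num.min (nm z + 1)^-1 ((nm z + nm (z - 1) - 1) / 4))).
have : e <= e by []; rewrite {2}/e !le_min.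
move=> /andP[/andP[e1 e2] /andP[e3 /andP[e4 e5]]].
have e0 : 0 < e by rewrite /e !lt_min ltr01 invr_gt0 !divr_gt0//; lra.
exists e; split=> //.
apply/nbhs_ballP; exists e%:C; first by rewrite /= ltcR.
move=> y; rewrite -ball_normE /= => yz.
have {}yz : nm (z - y) < e by rewrite -ltcR.
have h1 := nmB_ge z y; have h2 := nmB_ge (z - 1) (y - 1).
have h3 := nmB_ge y z.
rewrite (_ : z - 1 - (y - 1) = z - y) in h2; last by ring.
rewrite nmBC in h3.
split; try lra.
have : nm y <= nm z + 1 by lra.
move/le_trans; apply.
by rewrite -[leLHS]invrK lef_pV2// posrE invr_gt0; lra.
Qed.

(** The square root is the principal one here; its jump across the negative
    axis replaces t by - t. *)
Definition uval (z : C) : C := (sqrtc z - 1) / (sqrtc z + 1).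
Definition tval (z : C) : C := - (Clog (uval z) / 2).

Lemma sqrtc_neq (z : C) : ~ segment01 z ->
  [/\ z != 0, z - 1 != 0, sqrtc z != 0, sqrtc z - 1 != 0 & sqrtc z + 1 != 0].
Proof.
move=> zs.
have z0 : z != 0.
  apply/eqP => z0; apply: zs; exists 0 => //.
  by rewrite /= in_itv /= lexx ler01.
have z1 : z - 1 != 0.
  rewrite subr_eq0; apply/eqP => z1; apply: zs; exists 1 => //.
  by rewrite /= in_itv /= lexx ler01.
have E : z - 1 = (sqrtc z - 1) * (sqrtc z + 1).
  by rewrite -{1}(sqr_sqrtc z); ring.
have w0 : sqrtc z != 0 by rewrite sqrtc_eq0.
have : (sqrtc z - 1) * (sqrtc z + 1) != 0 by rewrite -E.
by rewrite mulf_eq0 negb_or => /andP[h1 h2]; split.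
Qed.

Lemma nm_sqrB1 (w : C) : nm (w + 1) * nm (w - 1) = nm (w ^+ 2 - 1).
Proof. by rewrite -nmM; congr nm; ring. Qed.

(** The cosine of the argument of u.  It depends on z continuously outside
    {1}, and is -1 exactly on the segment [0, 1[. *)
Lemma Re_uval (z : C) : ~ segment01 z ->
  complex.Re (uval z) / nm (uval z) = (nm z - 1) / nm (z - 1).
Proof.
move=> zs; have [z0 z1 w0 wm wp] := sqrtc_neq zs.
have n1 : 0 < nm (sqrtc z - 1) by rewrite nm_gt0.
have n2 : 0 < nm (sqrtc z + 1) by rewrite nm_gt0.
have -> : complex.Re (uval z) = (nm z - 1) / nm (sqrtc z + 1) ^+ 2.
  have -> : nm z = nm (sqrtc z) ^+ 2 by rewrite -nmX sqr_sqrtc.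
  rewrite /uval; move: (sqrtc z) => [a b].
  rewrite !nm_sqr /= addr0 subr0; ring.
have -> : nm (z - 1) = nm (sqrtc z + 1) * nm (sqrtc z - 1).
  by rewrite nm_sqrB1 sqr_sqrtc.
rewrite /uval nmM nmV; field; by rewrite !gt_eqF.
Qed.

Lemma uval_neq0 (z : C) : ~ segment01 z -> uval z != 0.
Proof.
by move=> /sqrtc_neq[_ _ _ h1 h2]; rewrite mulf_neq0// invr_eq0.
Qed.

Lemma uval_pos (z : C) : ~ segment01 z -> complex.Im (uval z) = 0 -> 0 < complex.Re (uval z).
Proof.
move=> zs i0; rewrite ltNge; apply/negP => r0.
have E := Re_uval zs; have T := segment_triangle zs.
have n1 : 0 < nm (z - 1) by rewrite nm_gt0; have [] := sqrtc_neq zs.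
have u0 : 0 < nm (uval z) by rewrite nm_gt0 uval_neq0.
have : complex.Re (uval z) = - nm (uval z).
  have := nm_sqr (uval z); rewrite i0 expr0n addr0 => S.
  have : (complex.Re (uval z) - nm (uval z)) * (complex.Re (uval z) + nm (uval z)) = 0.
    by rewrite -subr_sqr S subrr.
  by move=> /eqP; rewrite mulf_eq0 => /orP[] /eqP; lra.
move=> {}E'; move: E; rewrite E' mulNr mulfV ?gt_eqF// => {}E.
by have := divfK (lt0r_neq0 n1) (nm z - 1); rewrite -E; lra.
Qed.

Lemma CexpN2tval (z : C) : ~ segment01 z -> Cexp (- tval z) ^+ 2 = uval z.
Proof.
move=> zs; rewrite -CexpMn /tval opprK mulrC divfK ?pnatr_eq0//.
exact: CexpK (uval_neq0 zs).
Qed.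

Lemma onem_uval (z : C) : ~ segment01 z -> 1 - uval z = 2 / (sqrtc z + 1).
Proof. by move=> /sqrtc_neq[_ _ _ _ h]; rewrite /uval; field. Qed.

Lemma tval_neq0 (z : C) : ~ segment01 z -> tval z != 0.
Proof.
move=> zs; apply/eqP => t0; have := CexpN2tval zs.
rewrite t0 oppr0 Cexp0 expr1n => E; have := onem_uval zs.
rewrite -E subrr => /esym/eqP; rewrite mulf_eq0 invr_eq0 pnatr_eq0 /=.
by have [_ _ _ _ /negbTE ->] := sqrtc_neq zs.
Qed.

(** If rt z = - w, then u becomes 1/u and t becomes - t, so that w t does not
    change. *)
Lemma slimE (rt : C -> C) z : sqrt_branch rt -> ~ segment01 z ->
  slim rt z = 1 / (sqrtc z * (z - 1) * tval z).
Proof.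
move=> [rt2 _] zs; have [z0 z1 w0 wm wp] := sqrtc_neq zs.
have t0 := tval_neq0 zs; have u0 := uval_neq0 zs.
have L0 : Clog (uval z) != 0.
  by apply: contraNneq t0 => L; rewrite /tval L mul0r oppr0.
have zE : z = sqrtc z ^+ 2 by rewrite sqr_sqrtc.
have zE1 : z - 1 = (sqrtc z - 1) * (sqrtc z + 1) by rewrite {1}zE; ring.
have : rt z ^+ 2 == sqrtc z ^+ 2 by rewrite rt2// sqr_sqrtc.
rewrite eqf_sqr zE1 /slim /ufun /tval => /orP[] /eqP ->.
- rewrite -/(uval z); move: (Clog (uval z)) L0 => L L0; rewrite /uval.
  by field; rewrite L0 wp wm w0 -opprB oppr_eq0 wm.
- have e1 : - sqrtc z - 1 = - (sqrtc z + 1) by ring.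
  have e2 : - sqrtc z + 1 = - (sqrtc z - 1) by ring.
  have -> : (- sqrtc z - 1) / (- sqrtc z + 1) = (uval z)^-1.
    by rewrite e1 e2 /uval invf_div invrN mulrNN.
  rewrite ClogV//; last exact: uval_pos.
  move: (Clog (uval z)) L0 => L L0; rewrite /uval.
  by field; rewrite L0 wp wm w0 -opprB oppr_eq0 wm.
Qed.

(** Both ratios are 2 / (1 - u) times the ratio of the Eulerian polynomials at
    u, since 1 + w = 2 / (1 - u). *)
Lemma oddgf_ratioE m (z : C) : ~ segment01 z ->
  oddgf m (Cexp (- tval z)) != 0 ->
  (coth_poly R[i] m).[sqrtc z] != 0 /\
  2 * (oddgf m.+1 (Cexp (- tval z)) / oddgf m (Cexp (- tval z))) =
  (coth_poly R[i] m.+1).[sqrtc z] / (coth_poly R[i] m).[sqrtc z].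
Proof.
move=> zs; have [z0 z1 w0 wm wp] := sqrtc_neq zs.
have wp' : 1 + sqrtc z != 0 by rewrite addrC.
rewrite !horner_coth_poly// -/(uval z) /oddgf CexpN2tval//.
have u1 : 1 - uval z != 0 by rewrite onem_uval// mulf_neq0 ?invr_eq0 ?pnatr_eq0.
have q0 := Cexp_neq0 (- tval z).
move: (Cexp _) q0 => q q0 A0.
have B0 : (eulerianB R[i] m).[uval z] != 0.
  by apply: contraNneq A0 => ->; rewrite mulr0 mul0r.
split; first by rewrite mulf_neq0// expf_neq0.
have D0 : (1 - uval z) ^+ m.+1 != 0 by rewrite expf_neq0.
have W0 : (1 + sqrtc z) ^+ m != 0 by rewrite expf_neq0.
rewrite (exprS (1 - uval z) m.+1) (exprS (1 + sqrtc z) m).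
have -> : (1 + sqrtc z) = 2 / (1 - uval z) by rewrite onem_uval//; field.
move: ((1 - uval z) ^+ m.+1) D0 => D D0.
have : (2 / (1 - uval z)) ^+ m != 0 by rewrite expf_neq0// mulf_neq0 ?invr_eq0 ?pnatr_eq0.
move: ((2 / (1 - uval z)) ^+ m) => W {}W0.
move: (_.[_]) (_.[_]) B0 => B1 B B0.
by field; rewrite q0 B0 D0 W0 u1.
Qed.

(** On the negative axis the principal square root is not continuous; the
    polynomial Q shows that [XiTilde] is nevertheless holomorphic there.  The
    origin is excluded because of the quotient by x in [Xi]. *)
Lemma XiTilde_poly k : exists c : R[i], exists Q : {poly R[i]}, 
  [/\ c != 0, coth_poly R[i] (2 * k).+1 = 'X * (Q \Po 'X^2) &
   forall z : C, z != 0 -> XiTilde k.+1 z = c * Q.[z]].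
Proof.
have [_ [Q [_ HQ]]] := coth_poly_parity R[i] k.
exists ((-1) ^+ k.+2 / (2 ^+ (4 * k.+1 - 1) * ((2 * k.+1 - 1)`!)%:R)), Q; split=> //.
  rewrite mulf_neq0 ?signr_eq0 ?invr_eq0 ?mulf_neq0 ?expf_neq0 ?pnatr_eq0//.
  by rewrite -lt0n fact_gt0.
move=> z z0; rewrite /XiTilde /Xi.
have -> : (2 * k.+1 - 1 = (2 * k).+1)%N by lia.
have w0 : sqrtc z != 0 by rewrite sqrtc_eq0.
have wp : sqrtc z + 1 != 0.
  apply/eqP => /(congr1 (@complex.Re R)); have := Re_sqrtc_ge0 z.
  by case: (sqrtc z) => a b /=; lra.
rewrite -mulrA; congr (_ * _).
have -> : - ((1 - sqrtc z) / (1 + sqrtc z)) = (sqrtc z - 1) / (sqrtc z + 1).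
  by rewrite -mulNr opprB (addrC 1).
rewrite mulrAC -horner_coth_poly// HQ hornerM hornerX horner_comp hornerXn sqr_sqrtc.
by rewrite mulrC mulKf.
Qed.

(** Differentiating P(w) = w Q(w^2) gives Q'(z), and [coth_polyS] trades the
    derivative P' for the next polynomial of the family. *)
Lemma snE k (z : C) : ~ segment01 z ->
  oddgf (2 * k).+1 (Cexp (- tval z)) != 0 ->
  sn k.+1 z = 1 / (k.+1%:R - 1) *
    ((sqrtc z * (oddgf (2 * k).+2 (Cexp (- tval z)) /
                 oddgf (2 * k).+1 (Cexp (- tval z)) - sqrtc z) / (z - 1) - 1) / (2 * z)).
Proof.
move=> zs A0; have [z0 z1 w0 wm wp] := sqrtc_neq zs.
have [P0 rE] := oddgf_ratioE zs A0.
have [c [Q [c0 HQ HX]]] := XiTilde_poly k.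
rewrite /sn; congr (_ * _).
have dX : (XiTilde k.+1)^`()%classic z = c * Q^`().[z].
  have dQ := @is_deriveZ _ _ _ _ c _ _ _ (is_derive_horner Q z).
  have nz : \forall x \near z, x != 0.
    have := @cvgr_neq0 _ _ _ _ _ (fun x : C => x) z (@cvg_id _ (nbhs z)) z0.
    exact.
  have [_ E] := @near_eq_is_derive _ _ _ _ (XiTilde k.+1) _ _ _
    (filterS (fun x (x0 : x != 0) => esym (HX x x0)) nz) dQ.
  by rewrite derive1E E.
rewrite dX HX// invfM mulrACA mulfV// mul1r.
set rho := oddgf _ _ / _ in rE *.
have PE : (coth_poly R[i] (2 * k).+1).[sqrtc z] = sqrtc z * Q.[z].
  by rewrite HQ hornerM hornerX horner_comp hornerXn sqr_sqrtc.
have Q0 : Q.[z] != 0 by apply: contraNneq P0 => q0; rewrite PE q0 mulr0.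
have dP : (coth_poly R[i] (2 * k).+1)^`().[sqrtc z] = Q.[z] + 2 * z * Q^`().[z].
  rewrite HQ derivM derivX mul1r deriv_comp derivXn hornerD hornerM hornerX.
  rewrite !hornerM !horner_comp hornerMn !hornerXn sqr_sqrtc expr1.
  rewrite -mulr_natr; transitivity (Q.[z] + 2 * sqrtc z ^+ 2 * Q^`().[z]); first by ring.
  by rewrite sqr_sqrtc.
have : (coth_poly R[i] (2 * k).+2).[sqrtc z] = 2 * rho * (sqrtc z * Q.[z]).
  by rewrite rE -PE divfK.
rewrite coth_polyS hornerZ hornerD !hornerM hornerX !hornerD hornerN hornerXn hornerC.
rewrite sqr_sqrtc dP PE; move: (Q^`().[z]) (Q.[z]) Q0 => Q' q q0 E.
have {}E : (z - 1) * (2 * z * Q') = rho * (sqrtc z * q) - z * q - (z - 1) * q.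
  have z2 : z = sqrtc z * sqrtc z by rewrite -expr2 sqr_sqrtc.
  apply: (mulfI (_ : (2 : R[i]) != 0)); first by rewrite pnatr_eq0.
  transitivity (2 * (sqrtc z * (sqrtc z * q) + (z - 1) * (q + 2 * z * Q')) -
     2 * ((z - 1) * q) - 2 * (sqrtc z * sqrtc z * q)); first by ring.
  by rewrite E -z2; ring.
have -> : Q' = (rho * (sqrtc z * q) - sqrtc z ^+ 2 * q - (z - 1) * q) / ((z - 1) * (2 * z)).
  by rewrite sqr_sqrtc -E; field; rewrite z1 z0.
by field; rewrite q0 z1 z0.
Qed.

Section Uniform.
Variable e : R.

Let W := 2 + e^-1.

Lemma away_segment (z : C) : 0 < e -> away e z -> ~ segment01 z.
Proof.
move=> e0 [_ _ _ h] zs; have [x [x0 x1 xz]] : exists x : R, [/\ 0 <= x, x <= 1 & x%:C = z].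
  by case: zs => x /=; rewrite in_itv /= => /andP[x0 x1] xz; exists x.
have n0 : nm z = x by rewrite -xz nm_real ger0_norm.
have n1 : nm (z - 1) = 1 - x.
  have -> : z - 1 = (x - 1)%:C by rewrite -xz rmorphB rmorph1.
  by rewrite nm_real distrC ger0_norm// subr_ge0.
by rewrite n0 n1 in h; lra.
Qed.

Lemma away_sqrtc (z : C) : 0 < e -> e <= 1 -> away e z -> [/\ e <= nm (sqrtc z), nm (sqrtc z + 1) <= W,
   nm (sqrtc z - 1) <= W & e <= nm (sqrtc z + 1) * nm (sqrtc z - 1)].
Proof.
move=> e0 e1 [h1 h2 h3 h4].
have w2 : nm (sqrtc z) ^+ 2 = nm z by rewrite -nmX sqr_sqrtc.
have w0 := nm_ge0 (sqrtc z).
have ei : 0 < e^-1 by rewrite invr_gt0.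
have ww : nm (sqrtc z) <= 1 + e^-1.
  rewrite leNgt; apply/negP => h; rewrite expr2 in w2.
  have : (1 + e^-1) * (1 + e^-1) < nm (sqrtc z) * nm (sqrtc z).
    by rewrite ltr_pM//; lra.
  by rewrite w2; nra.
split.
- rewrite leNgt; apply/negP => h; rewrite expr2 in w2.
  have : nm (sqrtc z) * nm (sqrtc z) < e * e by rewrite ltr_pM.
  have ee : e * e <= e * 1 by rewrite ler_wpM2l// ltW.
  by rewrite w2; lra.
- by apply: le_trans (nmD _ _) _; rewrite nm1 /W; lra.
- by apply: le_trans (nmD _ _) _; rewrite nmN nm1 /W; lra.
- by rewrite nm_sqrB1 sqr_sqrtc.
Qed.

(** Re t is bounded because |w - 1| |w + 1| = |z - 1| and both factors are at
    most [W]; Im t is bounded away from pi/2 and - pi/2 through [Re_uval]; and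
    t stays away from 0 because 1 - u = 2 / (w + 1) does. *)
Lemma away_strip : 0 < e -> e <= 1 -> exists M d tau : R, [/\ 0 < d, 0 < tau &
  forall z, away e z -> strip M d (tval z) /\ tau <= nm (tval z)].
Proof.
move=> e0 e1.
have p := pi_gt0 R.
have ei : 0 < e^-1 by rewrite invr_gt0.
have W0 : 0 < W by rewrite /W; lra.
(* cos (arg u) >= -1 + k on the set considered *)
pose k := Num.min 1 (e / (1 + e^-1)).
have k0 : 0 < k by rewrite lt_min ltr01 divr_gt0//; lra.
have k1 : k <= 1 by rewrite ge_min lexx.
have kb : -1 <= -1 + k <= 1 by apply/andP; split; lra.
pose a := acos (-1 + k).
have api : a < pi by apply: acos_ltpi; apply/andP; split; lra.
have a0 : 0 <= a by apply: acos_ge0.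
pose M := ln (W ^+ 2 / e).
pose d := (pi - a) / 2.
have d0 : 0 < d by rewrite divr_gt0//; lra.
have [Q Q0 HQ] := @linear0_Cexp R M 2 (ltr0Sn _ 1) (lexx 2).
exists M, d, (2 / W / (Q + 1)); split=> //.
  by rewrite !divr_gt0//; lra.
move=> z hz; have zs := away_segment e0 hz.
have [w0 wp wm wb] := away_sqrtc e0 e1 hz.
have [h1 h2 h3 h4] := hz.
have u0 := uval_neq0 zs.
have n0 : 0 < nm (uval z) by rewrite nm_gt0.
have p1 : 0 < nm (sqrtc z + 1) by rewrite nm_gt0; have [] := sqrtc_neq zs.
have m1 : 0 < nm (sqrtc z - 1) by rewrite nm_gt0; have [] := sqrtc_neq zs.
have uE : nm (uval z) = nm (sqrtc z - 1) / nm (sqrtc z + 1) by rewrite nmM nmV.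
have WW : 0 < W ^+ 2 / e by rewrite divr_gt0 ?exprn_gt0.
have ub : nm (uval z) <= W ^+ 2 / e.
  rewrite uE ler_pdivrMr// mulrAC ler_pdivlMr//.
  have : nm (sqrtc z - 1) * e <= nm (sqrtc z - 1) * (nm (sqrtc z + 1) * nm (sqrtc z - 1)).
    by rewrite ler_wpM2l ?nm_ge0.
  move/le_trans; apply; rewrite mulrCA [leLHS]mulrC.
  by rewrite ler_pM2r// expr2 ler_pM ?nm_ge0.
have lb : (W ^+ 2 / e)^-1 <= nm (uval z).
  rewrite invf_div uE ler_pdivrMr ?exprn_gt0// mulrAC ler_pdivlMr//.
  have : e * nm (sqrtc z + 1) <= (nm (sqrtc z + 1) * nm (sqrtc z - 1)) * nm (sqrtc z + 1).
    by rewrite ler_wpM2r ?nm_ge0.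
  move/le_trans; apply; rewrite -mulrA mulrCA.
  by rewrite ler_pM2l// expr2 ler_pM ?nm_ge0.
have lnb : `|ln (nm (uval z))| <= M.
  rewrite ler_norml; apply/andP; split; last by rewrite ler_ln.
  by rewrite /M -lnV ?posrE// ler_ln ?posrE ?invr_gt0.
have t0 := tval_neq0 zs.
have half (x y : R) : (x +i* y) / 2 = (x / 2) +i* (y / 2) :> R[i].
  rewrite -[2 in LHS](rmorph_nat (real_complex R)) -fmorphV /=.
  by apply/eqP; rewrite eq_complex /= !(mulr0, subr0, add0r) eqxx /=.
have rT : complex.Re (tval z) = - (ln (nm (uval z)) / 2).
  by rewrite /tval /Clog half.
have iT : complex.Im (tval z) = - (Carg (uval z) / 2).
  by rewrite /tval /Clog half.
have n1 : 0 < nm (z - 1) by apply: lt_le_trans h2.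
have cb : -1 + k <= complex.Re (uval z) / nm (uval z).
  rewrite Re_uval// ler_pdivlMr// mulrDl mulN1r.
  have : k <= e / (1 + e^-1) by rewrite ge_min lexx orbT.
  have zb : nm (z - 1) <= 1 + e^-1.
    by apply: le_trans (nmD _ _) _; rewrite nmN nm1; lra.
  rewrite ler_pdivlMr; last by lra.
  have : k * nm (z - 1) <= k * (1 + e^-1) by rewrite ler_wpM2l// ltW.
  lra.
have cb1 : complex.Re (uval z) / nm (uval z) <= 1.
  by rewrite ler_pdivrMr// mul1r (le_trans (ler_norm _))// nm_Re.
have ab : acos (complex.Re (uval z) / nm (uval z)) <= a.
  rewrite leNgt; apply/negP => h.
  have cb2 : -1 <= complex.Re (uval z) / nm (uval z) <= 1 by apply/andP; split; lra.
  have i1 : a \in `[0, pi] by rewrite in_itv /= a0 ltW.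
  have i2 : acos (complex.Re (uval z) / nm (uval z)) \in `[0, pi].
    by rewrite in_itv /= acos_ge0// acos_lepi.
  move: h; rewrite -(ltr_cos i1 i2) !acosK ?in_itv//= => h; lra.
have ab0 : 0 <= acos (complex.Re (uval z) / nm (uval z)).
  by apply: acos_ge0; apply/andP; split; lra.
have Mb : `|ln (nm (uval z))| / 2 <= M.
  by have := normr_ge0 (ln (nm (uval z))); lra.
have st : strip M d (tval z).
  split=> //.
    by rewrite rT normrN normrM [`|2^-1|]ger0_norm.
  rewrite iT normrN normrM [`|2^-1|]ger0_norm//.
  have -> : `|Carg (uval z)| = acos (complex.Re (uval z) / nm (uval z)).
    by rewrite /Carg; case: ifP => _; rewrite ?normrN ger0_norm.
  by rewrite /d; lra.
have st0 : strip M 0 (tval z).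
  by case: st => s1 s2 s3; split=> //; rewrite subr0 (le_trans s3)//; lra.
split=> //.
have := HQ _ st0.
have -> : Cexp (- (2%:C * tval z)) = uval z.
  by rewrite -CexpN2tval// -CexpMn rmorph_nat [in RHS]mulrN.
rewrite nmBC onem_uval// nmM nmV nm_nat.
move=> hh; rewrite ler_pdivrMr; last by lra.
have : 2 / W <= 2 / nm (sqrtc z + 1) by rewrite ler_pM2l// lef_pV2.
have := nm_ge0 (tval z); lra.
Qed.

(** With k = n - 1 and r the ratio of [oddgf_ratio], the difference is
    ((1 + 1/k) (r - 1) + 1/k) / (w (z - 1) t)
    - (1 / (z - 1) + 1 / z) / (2 k). *)
Lemma sn_uniform (rt : C -> C) (eps : R) : 0 < e -> e <= 1 -> sqrt_branch rt -> 0 < eps ->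
  exists N, forall n, (N <= n)%N -> forall z, away e z -> nm (sn n z - slim rt z) <= eps.
Proof.
move=> e0 e1 rtb eps0.
have [M [d [tau [d0 tau0 H]]]] := away_strip e0 e1.
pose K := 1 / (e * e * tau); have K0 : 0 < K by rewrite divr_gt0 ?mulr_gt0.
pose K' := e^-1; have K'0 : 0 < K' by rewrite invr_gt0.
pose a := eps / (4 * K); have a0 : 0 < a by apply: divr_gt0 => //; exact: mulr_gt0.
have [m0 Hm] := oddgf_ratio M d0 a0.
have b0 : 0 < 2 * (K + K') / eps by rewrite divr_gt0// mulr_gt0// addr_gt0.
pose N0 := Num.bound (2 * (K + K') / eps).
exists (maxn (m0 + 2) (N0 + 3)) => -[|k]; rewrite geq_max; first by rewrite addnS.
rewrite !addnS !addn0 !ltnS => /andP[k1 k2] z hz.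
have k0 : (0 < k)%N by exact: leq_ltn_trans k1.
have mk : (m0 <= (2 * k).+1)%N.
  by rewrite ltnW// ltnS (leq_trans (ltnW k1))// leq_pmull.
have Nk : (N0 <= k)%N by rewrite ltnW// ltnW.
have zs := away_segment e0 hz.
have [z0 z1 w0 wm wp] := sqrtc_neq zs.
have [st tt] := H z hz.
have [A0 rb] := Hm _ mk _ st.
have kC : (k%:R : R[i]) != 0 by rewrite pnatr_eq0 -lt0n.
have kR : 0 < k%:R :> R by rewrite ltr0n.
have t0 := tval_neq0 zs.
rewrite snE// (slimE rtb zs).
set rho := oddgf _ _ / oddgf _ _ in rb *.
pose r := tval z / (2 * k).+2%:R * rho; rewrite -/r in rb.
have rhoE : rho = (2 * (k%:R + 1)) / tval z * r.
  have n2 : ((2 * k).+2%:R : R[i]) = 2 * (k%:R + 1) by rewrite -!natr1 natrM; ring.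
  have kp : k%:R + 1 != 0 :> R[i] by rewrite natr1 pnatr_eq0.
  by rewrite /r n2; move: (k%:R + 1) kp => x x0; field; rewrite t0 x0.
have -> : 1 / (k.+1%:R - 1) * ((sqrtc z * (rho - sqrtc z) / (z - 1) - 1) / (2 * z)) -
   1 / (sqrtc z * (z - 1) * tval z) =
   1 / (sqrtc z * (z - 1) * tval z) * ((1 + k%:R^-1) * (r - 1) + k%:R^-1) -
   k%:R^-1 * (2^-1 * ((z - 1)^-1 + z^-1)).
  rewrite -natr1 addrK rhoE.
  have zE : z = sqrtc z ^+ 2 by rewrite sqr_sqrtc.
  move: (r) (tval z) (sqrtc z) t0 w0 zE => x t w t0' w0' zE; rewrite zE in z1 *.
  by field; rewrite kC t0' w0' z1.
have nkV : nm (k%:R^-1 : R[i]) = k%:R^-1 by rewrite nmV nm_nat.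
apply: le_trans (nmD _ _) _; rewrite nmN nmM (nmM k%:R^-1) nkV.
have hK : nm (1 / (sqrtc z * (z - 1) * tval z)) <= K.
  rewrite nmM nm1 mul1r nmV !nmM /K mul1r lef_pV2 ?posrE ?mulr_gt0 ?nm_gt0//.
  have [h1 _ _ _] := away_sqrtc e0 e1 hz; have [_ h2 _ _] := hz.
  apply: ler_pM => //; [by rewrite mulr_ge0 ?ltW|exact: ltW|by apply: ler_pM => //; exact: ltW].
have kV1 : k%:R^-1 <= 1 :> R by rewrite invf_le1// ler1n.
have hr : nm ((1 + k%:R^-1) * (r - 1) + k%:R^-1) <= 2 * a + k%:R^-1.
  apply: le_trans (nmD _ _) _; rewrite nkV lerD2r nmM ler_pM ?nm_ge0//.
  by apply: le_trans (nmD _ _) _; rewrite nkV nm1; lra.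
have hK' : nm (2^-1 * ((z - 1)^-1 + z^-1)) <= K'.
  have [h1 h2 _ _] := hz.
  rewrite nmM nmV nm_nat ler_pdivrMl//; apply: le_trans (nmD _ _) _; rewrite !nmV.
  have : (nm (z - 1))^-1 <= K' by rewrite /K' lef_pV2 ?posrE ?nm_gt0.
  have : (nm z)^-1 <= K' by rewrite /K' lef_pV2 ?posrE ?nm_gt0.
  lra.
have t1 : nm (1 / (sqrtc z * (z - 1) * tval z)) *
    nm ((1 + k%:R^-1) * (r - 1) + k%:R^-1) <= K * (2 * a + k%:R^-1).
  by rewrite ler_pM ?nm_ge0.
have kV0 : 0 <= k%:R^-1 :> R by rewrite invr_ge0 ltW.
have t2 : k%:R^-1 * nm (2^-1 * ((z - 1)^-1 + z^-1)) <= k%:R^-1 * K'.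
  by rewrite ler_wpM2l.
have Ka : K * (2 * a) = eps / 2 by rewrite /a; field; rewrite gt_eqF.
have kk : k%:R^-1 * (K + K') <= eps / 2.
  rewrite ler_pdivrMl//; have : 2 * (K + K') / eps < k%:R.
    by apply: lt_le_trans (archi_boundP (ltW b0)) _; rewrite ler_nat.
  rewrite ltr_pdivrMr// => hh; lra.
move: t1; rewrite (mulrDr K) Ka; lra.
Qed.

End Uniform.
End Limit.

(** * The branch of the square root *)
Section Branch.
Variable R : realType.
Local Notation C := (Cplx R).
Local Notation nm := (@Normc.normc R).

(** The complement of ]-oo, 1] is star-shaped about 2. *)
Lemma segment_avoids (z : C) (s : R) : ~ halfline1 z -> 0 <= s -> s <= 1 ->
  ~ halfline1 (2 + s%:C * (z - 2)).
Proof.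
have [a [b ->]] : exists a b, z = a +i* b by case: z => a b; exists a, b.
move=> zh s0 s1 hz.
have [x x1] : exists2 x : R, x <= 1 & x%:C = 2 + s%:C * (a +i* b - 2).
  by case: hz => x /=; rewrite in_itv /= => x1 xz; exists x.
rewrite -(rmorph_nat (real_complex R)) => -[] /=.
rewrite !mul0r !subr0 !addr0 add0r => xE /esym/eqP; rewrite mulf_eq0 => /orP[/eqP s0'|/eqP b0].
  by rewrite s0' mul0r in xE; lra.
have a1 : 1 < a.
  rewrite ltNge; apply/negP => a1; apply: zh; exists a; last by rewrite b0.
  by rewrite /= in_itv.
have : 0 <= s * (a - 1) by rewrite mulr_ge0// subr_ge0 ltW.
nra.
Qed.

(** A square root with zero real part is a root of a nonpositive real, so the
    real part of the branch does not vanish along the segment from 2 to z. *)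
Lemma Re_branch_gt0 (rt : C -> C) : sqrt_branch rt ->
  (forall x : R, 1 < x -> 0 < rt x%:C) ->
  forall z : C, ~ halfline1 z -> 0 < complex.Re (rt z).
Proof.
move=> [rt2 rtd] rtpos z zh.
pose g (s : R) : C := 2 + s%:C * (z - 2).
pose f (s : R) : R := complex.Re (rt (g s)).
have gav s : 0 <= s <= 1 -> ~ halfline1 (g s).
  by move=> /andP[s0 s1]; exact: segment_avoids.
have hs (y : C) : ~ halfline1 y -> ~ segment01 y.
  move=> yh [x]; rewrite /= in_itv /= => /andP[_ x1] xy; apply: yh.
  by exists x => //; rewrite /= in_itv.
have fne s : 0 <= s <= 1 -> f s != 0.
  move=> s01; apply/eqP => f0; have gs := gav s s01; apply: (gs).
  exists (- (complex.Im (rt (g s))) ^+ 2).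
    by rewrite /= in_itv /=; have := sqr_ge0 (complex.Im (rt (g s))); lra.
  rewrite -[RHS](rt2 _ (hs _ gs)) !expr2; move: f0; rewrite /f.
  by case: (rt (g s)) => x y /= ->; apply/eqP; rewrite eq_complex /= !mul0r !mulr0 addr0 sub0r !eqxx.
have fc s : 0 <= s <= 1 -> {for s, continuous f}.
  move=> s01.
  have rc : {for g s, continuous rt}.
    by apply/differentiable_continuous/derivable1_diffP; exact/rtd/gav.
  apply/cvgrPdist_lt => eps eps0.
  have := rc; move=> /cvgrPdist_lt/(_ eps%:C).
  rewrite ltcR => /(_ eps0) /nbhs_ballP[d].
  rewrite /= => d0 hd.
  have dE : d = (complex.Re d)%:C by rewrite RRe_real// gtr0_real.
  have dR : 0 < complex.Re d by rewrite -ltcR -dE.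
  pose k := nm (z - 2) + 1.
  have k0 : 0 < k by rewrite /k; have := nm_ge0 (z - 2); lra.
  apply/nbhs_ballP; exists (complex.Re d / k); first by rewrite /= divr_gt0.
  move=> t st0; have st : `|s - t| < complex.Re d / k := st0.
  have : ball (g s) d (g t).
    rewrite -ball_normE /= dE.
    have -> : g s - g t = (s - t)%:C * (z - 2) by rewrite /g rmorphB; ring.
    suff : nm ((s - t)%:C * (z - 2)) < complex.Re d by rewrite -ltcR.
    rewrite nmM nm_real; move: st; rewrite ltr_pdivlMr//; apply: le_lt_trans.
    by rewrite ler_wpM2l// /k lerDl.
  move=> /hd; rewrite /f => h.
  have {h} : nm (rt (g s) - rt (g t)) < eps by rewrite -ltcR.
  apply: le_lt_trans; apply: le_trans (nm_Re _).
  by case: (rt (g s)) => ? ?; case: (rt (g t)).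
have f0 : 0 < f 0.
  rewrite /f /g mul0r addr0; have := rtpos 2 (ltr1n _ 2).
  by rewrite rmorph_nat ltcE => /andP[].
have -> : rt z = rt (g 1) by rewrite /g mul1r addrC subrK.
rewrite -/(f 1) ltNge; apply/negP => f1.
have fcc : {within `[0, 1], continuous f}.
  apply: continuous_in_subspaceT => x; rewrite inE /= in_itv /= => x01.
  exact: fc.
have [|c] := @IVT R f 0 1 0 ler01 fcc.
  by rewrite ge_min le_max f1 (ltW f0) orbT.
rewrite in_itv /= => c01 /eqP; apply/negP; exact: fne.
Qed.

Lemma branch_disc (rt : C -> C) : sqrt_branch rt ->
  (forall x : R, 1 < x -> 0 < rt x%:C) ->
  forall z : C, ~ halfline1 z -> `|ufun rt z| < 1.
Proof.
move=> rtb rtpos z zh; have a0 := Re_branch_gt0 rtb rtpos zh.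
suff : nm (ufun rt z) < 1 by rewrite -ltcR.
rewrite /ufun nmM nmV; move: (rt z) a0 => w a0.
have wp : 0 < nm (w + 1).
  rewrite nm_gt0; apply/eqP => /(congr1 (@complex.Re R)).
  by case: w a0 => a b /=; lra.
rewrite ltr_pdivrMr// mul1r -(ltr_pXn2r (_ : 0 < 2)%N) ?nnegrE ?nm_ge0//.
by rewrite !nm_sqr; case: w a0 {wp} => a b /= a0; lra.
Qed.

Lemma uniform_away (rt : C -> C) (e : R) : sqrt_branch rt -> 0 < e -> e <= 1 ->
  {uniform (away e), (fun n => @sn R n) @ \oo --> slim rt}.
Proof.
move=> rtb e0 e1 P /uniform_nbhs[E [entE sub]].
move: entE; rewrite -entourage_ballE => -[d /= d0 hd].
have dE : d = (complex.Re d)%:C by rewrite RRe_real// gtr0_real.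
have dR : 0 < complex.Re d by rewrite -ltcR -dE.
have d2 : 0 < complex.Re d / 2 by rewrite divr_gt0.
have [N HN] := sn_uniform e0 e1 rtb d2.
exists N => // n /= Nn; apply: sub => z hz; apply: hd => /=.
rewrite -ball_normE /= dE.
suff : nm (slim rt z - sn n z) < complex.Re d by rewrite -ltcR.
rewrite nmBC; apply: le_lt_trans (HN n Nn z hz) _; lra.
Qed.
End Branch.

Theorem lemma2p1 (R : realType) (rt : Cplx R -> Cplx R)
    (rt_branch : sqrt_branch rt) :
  ((forall x : R, 1 < x -> 0 < rt x%:C) ->
     forall z : Cplx R, ~ halfline1 z -> `|ufun rt z| < 1) /\
  (forall z : Cplx R, ~ segment01 z ->
     exists2 V : set (Cplx R),
       nbhs z V & {uniform V, (fun n => @sn R n) @ \oo --> slim rt}).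
Proof.
split=> [|z zs]; first exact: branch_disc.
have [e [e0 e1 zV]] := nbhs_away zs.
by exists (away e) => //; exact: uniform_away.
Qed.
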